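(* Let $\pi$ be a plane in $\mathrm{PG}(5,q)$ such that $\pi\cap\mathcal{V}(\mathbb{F}_q)=\emptyset$ and $\pi\cap \pi_{\mathcal{N}}\neq \emptyset$. Then, one of the following cases holds: (i) $\pi=\pi_{\mathcal{N}}$; (ii) $\pi\cap\pi_{\mathcal{N}}=\ell\in o_{12,1}$. In this case, $\pi$ has either $0$ or $q$ rank-$2$ points outside the nucleus plane. This defines two $K$-orbits of planes with point-orbit distributions $[0,q+1,0,q^2]$ and $[0,q+1,q,q^2-q]$; (iii) $\pi\cap\pi_{\mathcal{N}}=P$ is a point. In this case, $\pi$ has either $0$, $q$, $2q$ or $3q$ rank-$2$ points outside the nucleus plane. This defines (a) one $K$-orbit of planes with point-orbit distributions $OD_0(\pi)=[0,1,0,q^2+q]$, (b) one $K$-orbit with $OD_0(\pi)=[0,1,3q,q^2-2q]$, (c) two $K$-orbits with $OD_0(\pi)=[0,1,q,q^2]$, and (d) two $K$-orbits with $OD_0(\pi)=[0,1,2q,q^2-q]$.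
   Context: Let $q$ be even. The Veronese surface $\mathcal{V}(\mathbb{F}_q)\subset\mathrm{PG}(5,q)$ is the image of $(u_0,u_1,u_2)\mapsto(u_0^2,u_0u_1,u_0u_2,u_1^2,u_1u_2,u_2^2)$; a point $(y_0,\dots,y_5)$ is identified with the symmetric matrix $[y_0,y_1,y_2;\ y_1,y_3,y_4;\ y_2,y_4,y_5]$ and has the rank of this matrix. $K\cong\mathrm{PGL}(3,q)$ acts by $M\mapsto AMA^T$. The nucleus plane is $\pi_{\mathcal{N}}=\mathcal{Z}(Y_0,Y_3,Y_5)$, consisting of rank-2 points. $o_{12,1}$ denotes the $K$-orbit of lines (Lavrauw–Popiel classification) contained in $\pi_{\mathcal{N}}$, i.e. the lines of the nucleus plane. $OD_0(\pi)=[r_1,r_{2,n},r_{2,s},r_3]$ counts rank-1 points, points of $\pi\cap\pi_{\mathcal{N}}$, rank-2 points outside $\pi_{\mathcal{N}}$, and rank-3 points of $\pi$. *)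

(* Defs.v *)
From HB Require Import structures.
From mathcomp Require Import all_boot all_order all_fingroup all_algebra.
From mathcomp Require Import ring.

Set Implicit Arguments.
Unset Strict Implicit.
Unset Printing Implicit Defensive.

Import GRing.Theory VectorInternalTheory.
Local Open Scope ring_scope.

(* A subspace is stored as its canonical (row-reduced) matrix, hence over a   *)
(* finite field there are finitely many of them.                              *)
HB.instance Definition _ (F : finFieldType) (vT : vectType F) :=
  [Countable of {vspace vT} by <:].
HB.instance Definition _ (F : finFieldType) (vT : vectType F) :=
  [Finite of {vspace vT} by <:].

Section VeroneseSurface.

Variable F : finFieldType.

Implicit Types (y : 'rV[F]_6) (M : 'M[F]_3) (P W : {vspace 'rV[F]_6}).

(* PG(5,q): points, lines and planes are the vector subspaces of F^6 of       *)
(* dimension 1, 2 and 3; incidence is inclusion of subspaces.                 *)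
Definition points : {set {vspace 'rV[F]_6}} := [set P | \dim P == 1].
Definition lines : {set {vspace 'rV[F]_6}} := [set l | \dim l == 2].
Definition planes : {set {vspace 'rV[F]_6}} := [set W | \dim W == 3].

Definition pts W : {set {vspace 'rV[F]_6}} := [set P in points | (P <= W)%VS].

Definition sym_mx y : 'M[F]_3 :=
  \matrix_(i, j) nth 0 (nth [::] [:: [:: y 0 0; y 0 1; y 0 2];
                                     [:: y 0 1; y 0 3; y 0 4];
                                     [:: y 0 2; y 0 4; y 0 5]] i) j.

(* Inverse of sym_mx on symmetric matrices (reads the upper triangle).        *)
Definition sym_row M : 'rV[F]_6 :=
  \row_k [:: M 0 0; M 0 1; M 0 2; M 1 1; M 1 2; M 2 2]`_k.

Definition veronese_map (u : 'rV[F]_3) : 'rV[F]_6 :=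
  \row_k [:: u 0 0 ^+ 2; u 0 0 * u 0 1; u 0 0 * u 0 2;
             u 0 1 ^+ 2; u 0 1 * u 0 2; u 0 2 ^+ 2]`_k.

Definition veronese : {set {vspace 'rV[F]_6}} :=
  [set <[veronese_map u]>%VS | u : 'rV[F]_3 & u != 0].

(* vpick P spans P when P is a point; see pt_rank_line for independence of    *)
(* the chosen representative.                                                 *)
Definition pt_rank P : nat := \rank (sym_mx (vpick P)).

(* Z(Y_k)                                                                     *)
Definition coord_hyperplane (k : 'I_6) : {vspace 'rV[F]_6} :=
  lker (linfun (fun y : 'rV[F]_6 => y 0 k : F^o)).

Definition nucleus_plane : {vspace 'rV[F]_6} :=
  (coord_hyperplane 0%R :&: coord_hyperplane 3%R :&: coord_hyperplane 5%R)%VS.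

Definition cong_map (A : 'M[F]_3) y : 'rV[F]_6 :=
  sym_row (A *m sym_mx y *m A^T).

Definition cong_vspace (A : 'M[F]_3) W : {vspace 'rV[F]_6} :=
  (linfun (cong_map A) @: W)%VS.

Lemma sym_mxK : cancel sym_mx sym_row.
Proof.
move=> y; apply/rowP; case=> [[|[|[|[|[|[|k]]]]]] hk] //; rewrite !mxE /= ?mxE /=;
  by congr (y _ _); apply: val_inj.
Qed.

Lemma sym_rowK M : M^T = M -> sym_mx (sym_row M) = M.
Proof.
move=> /matrixP sM; apply/matrixP.
case=> [[|[|[|i]]] hi] //; case=> [[|[|[|j]]] hj] //; rewrite !mxE /= ?mxE /=;
  first [by congr (M _ _); apply: val_inj
        | by rewrite -[LHS]sM mxE; congr (M _ _); apply: val_inj].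
Qed.

Lemma tr_sym_mx y : (sym_mx y)^T = sym_mx y.
Proof.
by apply/matrixP; case=> [[|[|[|i]]] hi] //; case=> [[|[|[|j]]] hj] //; rewrite !mxE.
Qed.

Lemma sym_mx_linear : linear sym_mx.
Proof.
by move=> a y z; apply/matrixP; case=> [[|[|[|i]]] hi] //;
  case=> [[|[|[|j]]] hj] //; rewrite !mxE.
Qed.
HB.instance Definition _ :=
  GRing.isLinear.Build F 'rV[F]_6 'M[F]_3 _ sym_mx sym_mx_linear.

Lemma sym_row_linear : linear sym_row.
Proof.
by move=> a y z; apply/rowP; case=> [[|[|[|[|[|[|k]]]]]] hk] //; rewrite !mxE /= ?mxE.
Qed.
HB.instance Definition _ :=
  GRing.isLinear.Build F 'M[F]_3 'rV[F]_6 _ sym_row sym_row_linear.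

Lemma cong_map_linear A : linear (cong_map A).
Proof.
move=> a y z; rewrite /cong_map linearP /= mulmxDr mulmxDl -scalemxAr -scalemxAl.
by rewrite linearP.
Qed.
HB.instance Definition _ A :=
  GRing.isLinear.Build F 'rV[F]_6 'rV[F]_6 _ (cong_map A) (cong_map_linear A).

Lemma sym_mx_cong A y : sym_mx (cong_map A y) = A *m sym_mx y *m A^T.
Proof. by rewrite sym_rowK // !trmx_mul tr_sym_mx trmxK mulmxA. Qed.

Lemma cong_map1 y : cong_map 1%:M y = y.
Proof. by rewrite /cong_map trmx1 mulmx1 mul1mx sym_mxK. Qed.

Lemma cong_mapM A B y : cong_map (A *m B) y = cong_map A (cong_map B y).
Proof. by rewrite {1 2}/cong_map sym_mx_cong trmx_mul !mulmxA. Qed.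

Lemma cong_vspace1 W : cong_vspace 1%:M W = W.
Proof.
rewrite /cong_vspace (_ : linfun _ = \1%VF) ?lim1g //.
by apply/lfunP=> y; rewrite !lfunE /= cong_map1.
Qed.

Lemma cong_vspaceM A B W : cong_vspace (A *m B) W = cong_vspace A (cong_vspace B W).
Proof.
rewrite /cong_vspace -limg_comp; congr (_ @: _)%VS.
by apply/lfunP=> y; rewrite comp_lfunE !lfunE /= cong_mapM.
Qed.

Lemma GLmulmx (A B : {'GL_3[F]}) : val (A * B)%g = val A *m val B.
Proof. by []. Qed.

Lemma cong_vspace_inj (A : {'GL_3[F]}) : injective (cong_vspace (val A)).
Proof.
move=> U W /(congr1 (cong_vspace (val A^-1)%g)).
by rewrite -!cong_vspaceM -GLmulmx mulVg !cong_vspace1.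
Qed.

Definition cong_perm (A : {'GL_3[F]}) : {perm {vspace 'rV[F]_6}} :=
  perm (@cong_vspace_inj A).

(* K is the group of collineations M |-> A M A^T, A in GL(3,q), acting        *)
(* faithfully on subspaces; scalar matrices A give the identity, so that      *)
(* K ~ PGL(3,q).                                                              *)
Definition Kgrp : {set {perm {vspace 'rV[F]_6}}} :=
  [set cong_perm A | A : {'GL_3[F]}].

Fact Kgrp_group_set : group_set Kgrp.
Proof.
apply/group_setP; split.
  apply/imsetP; exists 1%g => //; apply/permP=> W.
  by rewrite perm1 permE cong_vspace1.
move=> _ _ /imsetP[A _ ->] /imsetP[B _ ->]; apply/imsetP; exists (B * A)%g => //.
by apply/permP=> W; rewrite permM !permE GLmulmx cong_vspaceM.
Qed.
Canonical Kgrp_group := Group Kgrp_group_set.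

Definition Korbits (S : {set {vspace 'rV[F]_6}}) :
    {set {set {vspace 'rV[F]_6}}} :=
  [set orbit 'P Kgrp W | W in S].

Definition o12_1 : {set {vspace 'rV[F]_6}} :=
  [set l in lines | (l <= nucleus_plane)%VS].

Definition r1 W : nat := #|[set P in pts W | pt_rank P == 1]|.
Definition r2n W : nat := #|pts W :&: pts nucleus_plane|.
Definition r2s W : nat :=
  #|[set P in pts W | (pt_rank P == 2) && (P \notin pts nucleus_plane)]|.
Definition r3 W : nat := #|[set P in pts W | pt_rank P == 3]|.

Definition OD0 W : seq nat := [:: r1 W; r2n W; r2s W; r3 W].

Lemma pt_rank_line y : y != 0 -> pt_rank <[y]>%VS = \rank (sym_mx y).
Proof.
move=> y0; rewrite /pt_rank.
have /vlineP[a Da] := memv_pick <[y]>%VS.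
have: vpick <[y]>%VS != 0 by rewrite vpick0 -dimv_eq0 dim_vline y0.
rewrite Da scaler_eq0 => /norP[a0 _].
by rewrite linearZ /= mxrank_scale_nz.
Qed.

Lemma mem_nucleus_plane y :
  (y \in nucleus_plane) = [&& y 0 0 == 0, y 0 3 == 0 & y 0 5 == 0].
Proof.
have coordP (k : 'I_6) : (y \in coord_hyperplane k) = (y 0 k == 0).
  rewrite memv_ker /linfun.
  have lk : linear (fun z : 'rV[F]_6 => z 0 k : F^o).
    by move=> a u v; rewrite !mxE.
  pose Lk := GRing.isLinear.Build F 'rV[F]_6 F^o _ _ lk.
  pose f : {linear 'rV[F]_6 -> F^o} := HB.pack (fun z : 'rV[F]_6 => z 0 k : F^o) Lk.
  by rewrite (lfunE f).
by rewrite !memv_cap !coordP andbA.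
Qed.

Lemma sym_mx_veronese u : sym_mx (veronese_map u) = u^T *m u.
Proof.
apply/matrixP; case=> [[|[|[|i]]] hi] //; case=> [[|[|[|j]]] hj] //;
  rewrite !mxE big_ord1 !mxE /= ?expr2; first
    [ by congr (u _ _ * u _ _); apply: val_inj
    | by rewrite mulrC; congr (u _ _ * u _ _); apply: val_inj ].
Qed.

(* In characteristic 2 the points of the nucleus plane are the matrices       *)
(* skew_mx w, on which A in GL(3,q) acts as w |-> w A^-1 up to a scalar.      *)
Definition skew_mx (w : 'rV[F]_3) : 'M[F]_3 :=
  \matrix_(i, j) nth 0 (nth [::] [:: [:: 0; w 0 2; - w 0 1];
                                     [:: - w 0 2; 0; w 0 0];
                                     [:: w 0 1; - w 0 0; 0]] i) j.

Lemma skew_mx_cong (A : 'M[F]_3) w :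
  A *m skew_mx (w *m A) *m A^T = \det A *: skew_mx w.
Proof.
pose a m n := A (inord m) (inord n); pose x n := w 0 (inord n).
have aE i j : A i j = a i j by rewrite /a !inord_val.
have xE j : w 0 j = x j by rewrite /x inord_val.
have -> : \det A = a 0 0 * (a 1 1 * a 2 2 - a 1 2 * a 2 1)
   - a 0 1 * (a 1 0 * a 2 2 - a 1 2 * a 2 0)
   + a 0 2 * (a 1 0 * a 2 1 - a 1 1 * a 2 0).
  rewrite (expand_det_row _ ord0) !big_ord_recl big_ord0 /cofactor.
  rewrite !(expand_det_row _ ord0) !big_ord_recl !big_ord0 /cofactor !det_mx11.
  rewrite !mxE !aE /=; ring.
apply/matrixP; case=> [[|[|[|i]]] hi] //; case=> [[|[|[|j]]] hj] //;
  do ![rewrite !mxE /= ?big_ord_recl ?big_ord0]; rewrite !aE !xE /= /bump /=; ring.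
Qed.

Definition nucleus_row (w : 'rV[F]_3) : 'rV[F]_6 := sym_row (skew_mx w).

Definition nucleus_coord y : 'rV[F]_3 := \row_j [:: y 0 4; - y 0 2; y 0 1]`_j.

Lemma nucleus_coord_linear : linear nucleus_coord.
Proof.
move=> a y z; apply/rowP; case=> [[|[|[|j]]] hj] //; rewrite !mxE //= ?mxE.
by rewrite opprD mulrN.
Qed.
HB.instance Definition _ := GRing.isLinear.Build F 'rV[F]_6 'rV[F]_3 _
  nucleus_coord nucleus_coord_linear.

Lemma nucleus_coordK y : y \in nucleus_plane -> nucleus_row (nucleus_coord y) = y.
Proof.
rewrite mem_nucleus_plane => /and3P[/eqP y0 /eqP y3 /eqP y5].
apply/rowP; case=> [[|[|[|[|[|[|k]]]]]] hk] //;
  rewrite !mxE /= ?mxE /= ?opprK; first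
    [ by congr (y _ _); apply: val_inj
    | by rewrite -[LHS]y0; congr (y _ _); apply: val_inj
    | by rewrite -[LHS]y3; congr (y _ _); apply: val_inj
    | by rewrite -[LHS]y5; congr (y _ _); apply: val_inj ].
Qed.

Lemma nucleus_rowK w : nucleus_coord (nucleus_row w) = w.
Proof.
apply/rowP; case=> [[|[|[|k]]] hk] //; rewrite !mxE /= ?mxE /= ?opprK;
 by congr (w _ _); apply: val_inj.
Qed.

Lemma nucleus_row_in w : nucleus_row w \in nucleus_plane.
Proof. by rewrite mem_nucleus_plane !mxE /= ?mxE /= !eqxx. Qed.

Lemma nucleus_row_cong (A : 'M[F]_3) w : 2 \in [pchar F] ->
  cong_map A (nucleus_row (w *m A)) = \det A *: nucleus_row w.
Proof.
move=> F2; rewrite /cong_map sym_rowK ?skew_mx_cong ?linearZ //.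
apply/matrixP; case=> [[|[|[|i]]] hi] //; case=> [[|[|[|j]]] hj] //;
  by rewrite !mxE /= ?oppr_pchar2.
Qed.

Definition line_mx W : 'M[F]_(\dim W, 3) :=
  \matrix_i nucleus_coord (vbasis W)`_i.

Lemma mul_line_mx W (x : 'rV_(\dim W)) :
  x *m line_mx W = nucleus_coord (\sum_i x 0 i *: (vbasis W)`_i).
Proof.
rewrite mulmx_sum_row linear_sum; apply: eq_bigr => i _.
by rewrite linearZ rowK.
Qed.

Lemma line_mxP W y : (W <= nucleus_plane)%VS ->
  reflect (exists2 w, (w <= line_mx W)%MS & y = nucleus_row w) (y \in W).
Proof.
move=> sW; apply: (iffP idP) => [Wy | [w /submxP[x ->] ->]].
  exists (nucleus_coord y); last by rewrite nucleus_coordK // (subvP sW).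
  rewrite {1}(coord_vbasis Wy); apply/submxP.
  exists (\row_i coord (vbasis W) i y); rewrite mul_line_mx.
  by congr (nucleus_coord _); apply: eq_bigr => i _; rewrite mxE.
have xW : \sum_i x 0 i *: (vbasis W)`_i \in W.
  by apply: memv_suml => i _; rewrite memvZ // vbasis_mem // mem_nth ?size_tuple.
by rewrite mul_line_mx nucleus_coordK // (subvP sW).
Qed.

Lemma rank_line_mx W : (W <= nucleus_plane)%VS -> \rank (line_mx W) = \dim W.
Proof.
move=> sW; apply/eqP; rewrite -[_ == _]/(row_free _) -kermx_eq0.
apply/rowV0P => x /sub_kermxP; rewrite mul_line_mx => /(congr1 nucleus_row).
have xW : \sum_i x 0 i *: (vbasis W)`_i \in W.
  by apply: memv_suml => i _; rewrite memvZ // vbasis_mem // mem_nth ?size_tuple.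
rewrite nucleus_coordK ?(subvP sW) // (_ : nucleus_row 0 = 0) => [x0|].
  have /freeP frW := basis_free (vbasisP W).
  by apply/rowP => i; rewrite [RHS]mxE; apply: (frW (x 0)).
by apply/rowP; case=> [[|[|[|[|[|[|k]]]]]] hk] //; rewrite !mxE /= ?mxE ?oppr0.
Qed.

(* o12_1 is indeed a single K-orbit when q is even.                           *)
Lemma o12_1_orbit l : 2 \in [pchar F] -> l \in o12_1 -> orbit 'P Kgrp l = o12_1.
Proof.
move=> F2; rewrite !inE => /andP[/eqP dl sl].
have dimK (A : {'GL_3[F]}) W : \dim (cong_vspace (val A) W) = \dim W.
  apply: limg_dim_eq; apply/eqP; rewrite -subv0; apply/subvP => y.
  rewrite memv_cap memv_ker lfunE /= memv0 => /andP[_ /eqP Ay0].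
  rewrite -[y]cong_map1 -(mulVmx (valP A)) cong_mapM Ay0.
  exact/eqP/linear0.
have imgP (A : {'GL_3[F]}) W v : v \in cong_vspace (val A) W ->
    exists2 y, y \in W & v = cong_map (val A) y.
  by case/memv_imgP => y Wy ->; exists y; rewrite ?lfunE.
apply/setP => m; apply/idP/idP.
  case/orbitP => _ /imsetP[A _ ->] <-.
  rewrite !inE /= /aperm permE dimK dl eqxx /=.
  apply/subvP => _ /imgP[_ /(line_mxP _ sl)[w _ ->] ->].
  by rewrite -[w](mulmxKV (valP A)) nucleus_row_cong // memvZ ?nucleus_row_in.
rewrite !inE => /andP[/eqP dm sm].
have rk : \rank (line_mx l) = \rank (line_mx m).
  by rewrite !rank_line_mx // dl dm.
have [f f_unit eqf] := eq_rank_unitmx rk.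
pose A : {'GL_3[F]} := Sub f f_unit.
rewrite (orbit_sym 'P Kgrp_group); apply/orbitP.
exists (cong_perm A); first exact: imset_f.
apply/eqP; rewrite /= /aperm permE eqEdim dimK dl dm leqnn andbT.
apply/subvP => _ /imgP[_ /(line_mxP _ sm)[w lw ->] ->].
move: lw; rewrite eqf => /submxP[x ->]; rewrite mulmxA nucleus_row_cong //.
by apply/memvZ/line_mxP => //; exists (x *m line_mx l); rewrite ?submxMl.
Qed.

End VeroneseSurface.

(* Main.v *)
(* In even characteristic a symmetric matrix is M = s^T s + [w], where s is the *)
(* square root of the diagonal and [w] is alternating, so det M = (w . s)^2,   *)
(* M has rank 1 iff w = 0, and M lies in the nucleus plane iff s = 0. A plane  *)
(* disjoint from the Veronese surface is thus the data of its nucleus part     *)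
(* (the w with s = 0), the subspace of its s, and w as a function of s modulo  *)
(* the nucleus part.                                                           *)
(* - If the nucleus part is a line, it is the annihilator of a point p, and    *)
(*   the orbit is decided by whether s is proportional to p.                   *)
(* - If it is a point w0, then s runs over the kernel of a linear form phi. If *)
(*   w0 = phi, then s |-> w(s) . s is a binary cubic with nonzero discriminant, *)
(*   determined up to GL(2,q) and scalars: it has 0, 1 or 3 roots, each root   *)
(*   gives q points of rank 2, and there is one orbit for each number of roots *)
(*   (Artin-Schreier theory if there is a root, a homography over the field    *)
(*   with q^3 elements otherwise). If w0 <> phi, elementary reductions give    *)
(*   three normal forms.                                                       *)

Require Import Defs.
From mathcomp Require Import all_boot all_order all_fingroup all_algebra.
Import GRing.Theory.
From HB Require Import structures.
From mathcomp Require Import all_field ring zify.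

Set Implicit Arguments.
Unset Strict Implicit.
Unset Printing Implicit Defensive.

Local Open Scope ring_scope.

(** In characteristic 2 the quadratic form of a symmetric matrix only sees its diagonal, u M u^T =
    sum u_i^2 M_ii, and every scalar of a finite field is a square. Let W be a plane without rank-1
    points that meets the nucleus plane. The dimension of their intersection is 1, 2 or 3, and it is
    preserved by K; dimension 3 means that W is the nucleus plane.

    Dimension 2: the lines of the nucleus plane form one orbit, so the line can be fixed. W is then
    generated by that line and one more matrix, and [line_plane_normal_form] leaves two planes.

    Dimension 1: the diagonals of W satisfy one linear relation, which a congruence turns into the
    vanishing of the last diagonal entry ([orbit_last_coord0]). The position of the nucleus point
    relative to that relation makes W a [cubic_plane] or a [flag_plane] ([point_plane_reduction]).
    Congruences realise linear substitutions and scalings of the binary cubic ([cubic_plane_subst]),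
    so a cubic with three roots or one root has a normal form ([cubic_plane_root_normal_form]), and
    all cubics without a root are equivalent ([rootless_cubic_planes]). Flag planes have three
    normal forms ([flag_plane_normal_form]).

    The total number of points leaves only [r2s] to compute ([OD0_veronese_free]), by counting
    singular matrices outside the nucleus plane. It separates all the orbits but two pairs, for
    which [nucleus_tangent] and [common_conjugates] are used. Finally [card_Korbits_OD0] converts a
    list of representatives into the numbers of orbits. *)

Lemma pchar2_even (F : fieldType) n : 2 \in [pchar F] -> n.*2%:R = 0 :> F.
Proof. by move=> F2; rewrite -mul2n natrM pcharf0 ?mul0r. Qed.

Lemma pchar2_eq (F : fieldType) (a b : F) :
  2 \in [pchar F] -> a + b = 0 -> a = b.
Proof. by move=> F2 /eqP; rewrite addr_eq0 oppr_pchar2// => /eqP. Qed.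

Lemma addr_eq0_pchar2 (F : fieldType) (a b : F) :
  2 \in [pchar F] -> (a + b == 0) = (a == b).
Proof. by move=> F2; rewrite addr_eq0 oppr_pchar2. Qed.

Lemma pchar2_evens (F : fieldType) : 2 \in [pchar F] ->
  [/\ 2 = 0 :> F, 4 = 0 :> F, 6 = 0 :> F & 8 = 0 :> F]
    /\ [/\ - 2 = 0 :> F, - 4 = 0 :> F & 12 = 0 :> F].
Proof.
move=> F2; do !split; rewrite ?(pchar2_even 1) ?(pchar2_even 2)
  ?(pchar2_even 3) ?(pchar2_even 4) ?(pchar2_even 6) ?oppr0 //.
Qed.

(* [ring] cancels a monomial by a hypothesis [c = 0] only if its coefficient *)
(* is literally [c]; hence the list of even constants.                       *)
Ltac ring2 := intros;
  match goal with ch : is_true (2 \in [pchar _]) |- _ =>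
    apply: (pchar2_eq ch); have [[? ? ? ?] [? ? ?]] := pchar2_evens ch
  end;
  match goal with
    h2 : 2 = 0, h4 : 4 = 0, h6 : 6 = 0, h8 : 8 = 0,
    m2 : - 2 = 0, m4 : - 4 = 0, h12 : 12 = 0 |- _ =>
    ring: h2 h4 h6 h8 m2 m4 h12
  end.

(** * Explicit coordinates for vectors, matrices and congruences *)

Section Coordinates.

Variable F : finFieldType.

Definition row6 (a b c d e f : F) : 'rV[F]_6 := \row_k [:: a; b; c; d; e; f]`_k.
Definition row3 (a b c : F) : 'rV[F]_3 := \row_k [:: a; b; c]`_k.
Definition mx3 (a b c d e f g h i : F) : 'M[F]_3 :=
  \matrix_(r, s) nth 0 (nth [::] [:: [:: a; b; c]; [:: d; e; f]; [:: g; h; i]] r) s.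

Lemma row6_eta (y : 'rV[F]_6) : y = row6 (y 0 0) (y 0 1) (y 0 2) (y 0 3) (y 0 4) (y 0 5).
Proof.
by apply/rowP; case=> [[|[|[|[|[|[|k]]]]]] hk] //; rewrite !mxE /=;
   congr (y _ _); apply: val_inj.
Qed.

Lemma row6P (y : 'rV[F]_6) : exists a b c d e f, y = row6 a b c d e f.
Proof. by do 6!eexists; apply: row6_eta. Qed.

Lemma row3_eta (y : 'rV[F]_3) : y = row3 (y 0 0) (y 0 1) (y 0 2).
Proof.
by apply/rowP; case=> [[|[|[|k]]] hk] //; rewrite !mxE /=;
   congr (y _ _); apply: val_inj.
Qed.

Lemma row3P (y : 'rV[F]_3) : exists a b c, y = row3 a b c.
Proof. by do 3!eexists; apply: row3_eta. Qed.

Lemma row6E a b c d e f :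
  (row6 a b c d e f 0 0 = a) * (row6 a b c d e f 0 1 = b) *
  (row6 a b c d e f 0 2 = c) * (row6 a b c d e f 0 3 = d) *
  (row6 a b c d e f 0 4 = e) * (row6 a b c d e f 0 5 = f).
Proof. by rewrite !mxE. Qed.

Lemma row3E a b c :
  (row3 a b c 0 0 = a) * (row3 a b c 0 1 = b) * (row3 a b c 0 2 = c).
Proof. by rewrite !mxE. Qed.

Lemma row6_inj a b c d e f a' b' c' d' e' f' :
  row6 a b c d e f = row6 a' b' c' d' e' f' ->
  [/\ a = a', b = b' & c = c'] /\ [/\ d = d', e = e' & f = f'].
Proof.
move=> E; have c_ k := congr1 (fun z : 'rV[F]_6 => z 0 k) E.
by move: (c_ 0) (c_ 1) (c_ 2) (c_ 3) (c_ 4) (c_ 5); rewrite !row6E.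
Qed.

Lemma row6D a b c d e f a' b' c' d' e' f' :
  row6 a b c d e f + row6 a' b' c' d' e' f' =
  row6 (a + a') (b + b') (c + c') (d + d') (e + e') (f + f').
Proof. by apply/rowP; case=> [[|[|[|[|[|[|k]]]]]] hk] //; rewrite !mxE. Qed.

Lemma row6Z k a b c d e f :
  k *: row6 a b c d e f = row6 (k * a) (k * b) (k * c) (k * d) (k * e) (k * f).
Proof. by apply/rowP; case=> [[|[|[|[|[|[|i]]]]]] hk] //; rewrite !mxE. Qed.

Lemma row6_0 : row6 0 0 0 0 0 0 = 0.
Proof. by apply/rowP; case=> [[|[|[|[|[|[|i]]]]]] hk] //; rewrite !mxE. Qed.

Lemma row3_0 : row3 0 0 0 = 0.
Proof. by apply/rowP; case=> [[|[|[|i]]] hk] //; rewrite !mxE. Qed.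

Lemma row3_eq0 a b c : (row3 a b c == 0) = [&& a == 0, b == 0 & c == 0].
Proof.
apply/eqP/and3P => [E|[/eqP-> /eqP-> /eqP->]]; last exact: row3_0.
have := row3E a b c; rewrite E /= => -[[<- <-] <-].
by rewrite !mxE !eqxx.
Qed.

Lemma veronese_map_row3 a b c :
  veronese_map (row3 a b c) = row6 (a ^+ 2) (a * b) (a * c) (b ^+ 2) (b * c) (c ^+ 2).
Proof. by rewrite /veronese_map !row3E. Qed.

Lemma sym_mx_row6 a b c d e f :
  sym_mx (row6 a b c d e f) = mx3 a b c b d e c e f.
Proof. by rewrite /sym_mx !row6E. Qed.

Lemma cong_map_mx3 m00 m01 m02 m10 m11 m12 m20 m21 m22 a b c d e f :
  let Q u0 u1 u2 v0 v1 v2 := u0 * (a * v0 + b * v1 + c * v2)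
    + u1 * (b * v0 + d * v1 + e * v2) + u2 * (c * v0 + e * v1 + f * v2) in
  cong_map (mx3 m00 m01 m02 m10 m11 m12 m20 m21 m22) (row6 a b c d e f) =
  row6 (Q m00 m01 m02 m00 m01 m02) (Q m00 m01 m02 m10 m11 m12)
       (Q m00 m01 m02 m20 m21 m22) (Q m10 m11 m12 m10 m11 m12)
       (Q m10 m11 m12 m20 m21 m22) (Q m20 m21 m22 m20 m21 m22).
Proof.
move=> Q; rewrite /cong_map /sym_row sym_mx_row6.
apply/rowP; case=> [[|[|[|[|[|[|k]]]]]] hk] //;
  do ![rewrite !mxE /= ?big_ord_recl ?big_ord0]; rewrite /= /Q; ring.
Qed.

Lemma det_mx3 a b c d e f g h i :
  \det (mx3 a b c d e f g h i) =
    a * (e * i - f * h) - b * (d * i - f * g) + c * (d * h - e * g).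
Proof.
rewrite (expand_det_row _ ord0) !big_ord_recl big_ord0 /cofactor.
rewrite !(expand_det_row _ ord0) !big_ord_recl !big_ord0 /cofactor !det_mx11.
rewrite !mxE /=; ring.
Qed.

Lemma det_sym_mx a b c d e f : 2 \in [pchar F] ->
  \det (sym_mx (row6 a b c d e f)) =
    a * e ^+ 2 + d * c ^+ 2 + f * b ^+ 2 + a * d * f.
Proof. move=> F2; rewrite sym_mx_row6 det_mx3; ring2. Qed.

Lemma unitmx_mx3 a b c d e f g h i :
  a * (e * i - f * h) - b * (d * i - f * g) + c * (d * h - e * g) != 0 ->
  mx3 a b c d e f g h i \in unitmx.
Proof. by rewrite unitmxE det_mx3 unitfE. Qed.

Lemma mem_nucleus_row6 a b c d e f :
  (row6 a b c d e f \in nucleus_plane F) = [&& a == 0, d == 0 & f == 0].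
Proof. by rewrite mem_nucleus_plane !row6E. Qed.

End Coordinates.

Arguments row6 {F} (a b c d e f)%_ring_scope.
Arguments row3 {F} (a b c)%_ring_scope.

(** * Spans of three vectors *)

Section VectorSpans.

Variables (F : finFieldType) (vT : vectType F).
Implicit Types u v w y : vT.

Lemma mem_span3P u v w y :
  reflect (exists a b c, y = a *: u + b *: v + c *: w) (y \in <<[:: u; v; w]>>%VS).
Proof.
rewrite !span_cons span_nil addv0; apply: (iffP memv_addP).
  case=> _ /vlineP[a ->] [_ /memv_addP[_ /vlineP[b ->] [_ /vlineP[c ->] ->]] ->].
  by exists a, b, c; rewrite addrA.
case=> a [b [c ->]]; exists (a *: u); first exact/memvZ/memv_line.
exists (b *: v + c *: w); last by rewrite addrA.
apply/memv_addP; exists (b *: v); first exact/memvZ/memv_line.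
by exists (c *: w); first exact/memvZ/memv_line.
Qed.

Lemma free3P u v w :
  (forall a b c, a *: u + b *: v + c *: w = 0 -> [/\ a = 0, b = 0 & c = 0]) ->
  free [:: u; v; w].
Proof.
move=> fr; apply/(@freeP _ _ 3 [tuple u; v; w]) => k.
rewrite !big_ord_recl big_ord0 addr0 addrA /= => /fr[k0 k1 k2].
by case=> [[|[|[|i]]] hi] //; [rewrite -[RHS]k0 | rewrite -[RHS]k1 | rewrite -[RHS]k2];
  congr k; apply: val_inj.
Qed.

Lemma free3_inj u v w a b c a' b' c' : free [:: u; v; w] ->
  a *: u + b *: v + c *: w = a' *: u + b' *: v + c' *: w ->
  [/\ a = a', b = b' & c = c'].
Proof.
move=> /(@freeP _ _ 3 [tuple u; v; w]) fr E.
pose k (i : 'I_3) := nth 0 [:: a - a'; b - b'; c - c'] i.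
have: \sum_(i < 3) k i *: [tuple u; v; w]`_i = 0.
  rewrite !big_ord_recl big_ord0 addr0 /k /= !scalerBl.
  transitivity ((a *: u + b *: v + c *: w) - (a' *: u + b' *: v + c' *: w)).
    by rewrite addrA !opprD [RHS]addrACA [X in _ = X + _]addrACA.
  by rewrite E subrr.
move/fr => k0; split; apply/eqP; rewrite -subr_eq0; apply/eqP.
- exact: (k0 0).
- exact: (k0 1).
- exact: (k0 2).
Qed.

End VectorSpans.

(** * Square roots, rank-1 points, and what the action of K preserves *)

Section CharTwo.

Variable F : finFieldType.
Hypothesis F2 : 2 \in [pchar F].
Implicit Types (W : {vspace 'rV[F]_6}) (A : 'M[F]_3) (y : 'rV[F]_6).

Lemma sqr_inj_pchar2 : injective (fun x : F => x ^+ 2).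
Proof.
move=> x y /eqP; rewrite -(addr_eq0_pchar2 _ _ F2) => /eqP E.
apply/eqP; rewrite -(addr_eq0_pchar2 _ _ F2) -sqrf_eq0; apply/eqP.
rewrite -[RHS]E; ring2.
Qed.

(** Squaring is injective because x^2 + y^2 = (x + y)^2, hence bijective on a finite field. *)
Lemma sqrt_pchar2 (x : F) : exists r, r ^+ 2 = x.
Proof. by have [g _ gK] := injF_bij sqr_inj_pchar2; exists (g x). Qed.

(* M i j ^ 2 = M i i * M j j, so M = u^T u with u the square root of the       *)
(* diagonal.                                                                  *)
Lemma rank1_veronese y : \rank (sym_mx y) = 1 -> exists u, y = veronese_map u.
Proof.
move: y => y0; have [a [b [c [d [e [f ->]]]]]] := row6P y0.
rewrite sym_mx_row6; set M := mx3 _ _ _ _ _ _ _ _ _ => rM.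
have minor i j k l : M i j * M k l = M i l * M k j.
  rewrite -(mulmx_base M) !mxE; move: (col_base M) (row_base M).
  by rewrite rM => C R; rewrite !big_ord1; ring.
have eM : [/\ b ^+ 2 = a * d, c ^+ 2 = a * f & e ^+ 2 = d * f].
  by split; rewrite expr2; [have:= minor 0 1 1 0 | have:= minor 0 2 2 0
    | have:= minor 1 2 2 1]; rewrite !mxE.
case: eM => eb ec ee.
have [[x ex] [z ez] [t et]] := And3 (sqrt_pchar2 a) (sqrt_pchar2 d) (sqrt_pchar2 f).
exists (row3 x z t); rewrite veronese_map_row3 ex ez et.
by congr row6; apply: sqr_inj_pchar2; rewrite exprMn ?ex ?ez ?et.
Qed.

(** Disjointness from the Veronese surface, phrased on vectors; [veronese_freeP] links it to the set
    of points. *)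
Definition veronese_free W := forall u, veronese_map u \in W -> u = 0.

Lemma veronese_map_eq0 (u : 'rV[F]_3) : veronese_map u = 0 -> u = 0.
Proof.
have [a [b [c ->]]] := row3P u; rewrite veronese_map_row3 -(@row6_0 F).
case/row6_inj => -[/eqP + _ _] [/eqP + _ /eqP]; rewrite !sqrf_eq0.
by move=> /eqP-> /eqP-> /eqP->; rewrite row3_0.
Qed.

Lemma veronese_freeP W :
  reflect (veronese_free W) (pts W :&: veronese F == set0).
Proof.
apply: (iffP eqP) => [W0 u Wu | W0].
  apply/eqP/negPn/negP => u0; have vu0 : veronese_map u != 0.
    by apply: contra u0 => /eqP/veronese_map_eq0 ->.
  have := in_set0 <[veronese_map u]>%VS; rewrite -W0 !inE dim_vline vu0 eqxx /=.
  by rewrite -memvE Wu /= => /negP; apply; apply: imset_f; rewrite inE.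
apply/setP => P; rewrite !inE; apply/negP => /andP[/andP[_ sP] /imsetP[u]].
rewrite inE => u0 eP; case/negP: u0; apply/eqP/W0.
by apply: (subvP sP); rewrite eP memv_line.
Qed.

Lemma cong_vspaceP A W y :
  reflect (exists2 z, z \in W & y = cong_map A z) (y \in cong_vspace A W).
Proof.
by apply: (iffP memv_imgP) => -[z Wz ->]; exists z; rewrite ?lfunE.
Qed.

Lemma cong_map_inj A : A \in unitmx -> injective (cong_map A).
Proof.
move=> uA y z /(congr1 (cong_map (invmx A))).
by rewrite -!cong_mapM mulVmx // !cong_map1.
Qed.

Lemma dim_cong A W : A \in unitmx -> \dim (cong_vspace A W) = \dim W.
Proof.
move=> uA; apply: limg_dim_eq; apply/eqP; rewrite -subv0; apply/subvP => y.
rewrite memv_cap memv_ker lfunE /= memv0 => /andP[_ /eqP Ay0].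
by apply/eqP/(cong_map_inj uA); rewrite Ay0 linear0.
Qed.

Lemma orbit_cong A W : A \in unitmx -> cong_vspace A W \in orbit 'P (Kgrp F) W.
Proof.
move=> uA; pose B : {'GL_3[F]} := Sub A uA.
apply/orbitP; exists (cong_perm B); first exact: imset_f.
by rewrite /= /aperm permE.
Qed.

Lemma orbit_congP W W' : W' \in orbit 'P (Kgrp F) W ->
  exists2 A, A \in unitmx & W' = cong_vspace A W.
Proof.
case/orbitP => _ /imsetP[A _ ->] <-; exists (val A); first exact: (valP A).
by rewrite /= /aperm permE.
Qed.

Lemma orbit_intro A W W' : A \in unitmx -> (\dim W' <= \dim W)%N ->
  (forall y, y \in W -> cong_map A y \in W') -> W' \in orbit 'P (Kgrp F) W.
Proof.
move=> uA dW sW; suff -> : W' = cong_vspace A W by apply: orbit_cong.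
apply/esym/eqP; rewrite eqEdim dim_cong // dW andbT.
by apply/subvP => _ /cong_vspaceP[y Wy ->]; apply: sW.
Qed.

Lemma cong_veronese A u : cong_map A (veronese_map u) = veronese_map (u *m A^T).
Proof.
by apply: (can_inj (@sym_mxK F)); rewrite sym_mx_cong !sym_mx_veronese
  trmx_mul trmxK !mulmxA.
Qed.

Lemma rank_cong A y : A \in unitmx -> \rank (sym_mx (cong_map A y)) = \rank (sym_mx y).
Proof.
move=> uA; rewrite sym_mx_cong mxrankMfree ?row_free_unit ?unitmx_tr //.
by rewrite eqmxMfull // row_full_unit.
Qed.

(** By [nucleus_row_cong] a congruence by B sends the alternating matrix of w to a multiple of that
    of w B^-1; the converse inclusion uses the inverse congruence. *)
Lemma cong_nucleus A y : A \in unitmx ->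
  (cong_map A y \in nucleus_plane F) = (y \in nucleus_plane F).
Proof.
suff H B z : B \in unitmx -> z \in nucleus_plane F ->
    cong_map B z \in nucleus_plane F.
  move=> uA; apply/idP/idP; last exact: H.
  by move/(H (invmx A) _); rewrite unitmx_inv -cong_mapM mulVmx // cong_map1; apply.
move=> uB /nucleus_coordK <-; set w := nucleus_coord z.
by rewrite -[w](mulmxKV uB) nucleus_row_cong // memvZ // nucleus_row_in.
Qed.

Lemma veronese_free_cong A W : A \in unitmx ->
  veronese_free W -> veronese_free (cong_vspace A W).
Proof.
move=> uA fW u /cong_vspaceP[z Wz E].
have uA' : A^T \in unitmx by rewrite unitmx_tr.
move: E; rewrite -[u](mulmxKV uA') -cong_veronese => /(cong_map_inj uA) E.
by rewrite [u *m _]fW ?mul0mx // E.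
Qed.

Lemma cong_cap_nucleus A W : A \in unitmx ->
  (cong_vspace A W :&: nucleus_plane F)%VS = cong_vspace A (W :&: nucleus_plane F).
Proof.
move=> uA; apply/vspaceP => y; rewrite memv_cap; apply/andP/cong_vspaceP.
  by case=> /cong_vspaceP[z Wz ->]; rewrite cong_nucleus // => Nz; exists z;
     rewrite // memv_cap Wz.
case=> z; rewrite memv_cap => /andP[Wz Nz] ->; rewrite cong_nucleus //; split=> //.
by apply/cong_vspaceP; exists z.
Qed.

Lemma pts_cong A W : A \in unitmx ->
  pts (cong_vspace A W) = [set cong_vspace A P | P in pts W].
Proof.
move=> uA; apply/setP => P; apply/idP/imsetP => [|[Q]]; last first.
  rewrite !inE => /andP[dQ sQ] ->; rewrite dim_cong // dQ /=.
  by rewrite /cong_vspace limgS.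
rewrite !inE => /andP[dP sP]; exists (cong_vspace (invmx A) P).
  rewrite !inE dim_cong ?unitmx_inv // dP /=.
  by rewrite -[W]cong_vspace1 -(mulVmx uA) cong_vspaceM /cong_vspace limgS.
by rewrite -cong_vspaceM mulmxV // cong_vspace1.
Qed.

Lemma pointP (P : {vspace 'rV[F]_6}) : P \in points F -> exists2 y, y != 0 & P = <[y]>%VS.
Proof.
rewrite inE => /eqP dP; exists (vpick P).
  by rewrite vpick0 -dimv_eq0 dP.
apply/eqP; rewrite eq_sym eqEdim dim_vline vpick0 -dimv_eq0 dP andbT.
by rewrite -memvE memv_pick.
Qed.

Lemma pts_points W P : P \in pts W -> P \in points F.
Proof. by rewrite !inE => /andP[]. Qed.

Lemma cong_line A y : cong_vspace A <[y]> = <[cong_map A y]>%VS.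
Proof. by rewrite /cong_vspace limg_line lfunE. Qed.

Lemma pt_rank_cong A P : A \in unitmx -> P \in points F ->
  pt_rank (cong_vspace A P) = pt_rank P.
Proof.
move=> uA /pointP[y y0 ->]; rewrite cong_line !pt_rank_line ?rank_cong //.
by apply: contra y0 => /eqP E; apply/eqP/(cong_map_inj uA); rewrite E linear0.
Qed.

Lemma mem_pts_line W y : y != 0 -> (<[y]>%VS \in pts W) = (y \in W).
Proof. by move=> y0; rewrite !inE dim_vline y0 -memvE. Qed.

Lemma pts_nucleus_cong A P : A \in unitmx -> P \in points F ->
  (cong_vspace A P \in pts (nucleus_plane F)) = (P \in pts (nucleus_plane F)).
Proof.
move=> uA /pointP[y y0 ->]; rewrite cong_line !mem_pts_line ?cong_nucleus //.
by apply: contra y0 => /eqP E; apply/eqP/(cong_map_inj uA); rewrite E linear0.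
Qed.

Lemma card_pts_cong A W (p : pred {vspace 'rV[F]_6}) : A \in unitmx ->
  {in points F, forall P, p (cong_vspace A P) = p P} ->
  #|[set P in pts (cong_vspace A W) | p P]| = #|[set P in pts W | p P]|.
Proof.
move=> uA pA; have injA : injective (cong_vspace A).
  by apply: (can_inj (g := cong_vspace (invmx A))) => U;
     rewrite -cong_vspaceM mulVmx // cong_vspace1.
rewrite -[RHS](card_imset _ injA); congr #|pred_of_set _|; apply/setP => Q.
rewrite in_set pts_cong //; apply/andP/imsetP => [[/imsetP[P WP ->] pP]|[P + ->]].
  by exists P; rewrite // inE WP -pA // (pts_points WP).
rewrite inE => /andP[WP pP]; split; first exact: imset_f.
by rewrite pA // (pts_points WP).
Qed.

Lemma OD0_cong A W : A \in unitmx -> OD0 (cong_vspace A W) = OD0 W.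
Proof.
move=> uA; rewrite /OD0 /r1 /r2n /r2s /r3.
have setIE (S T : {set {vspace 'rV[F]_6}}) : S :&: T = [set P in S | P \in T].
  by apply/setP => P; rewrite !inE.
rewrite !setIE !card_pts_cong // => P pP; rewrite ?pt_rank_cong //.
  by rewrite pts_nucleus_cong.
by rewrite pts_nucleus_cong.
Qed.

Lemma OD0_orbit W W' : W' \in orbit 'P (Kgrp F) W -> OD0 W' = OD0 W.
Proof. by case/orbit_congP => A uA ->; rewrite OD0_cong. Qed.

End CharTwo.

Lemma card_set_sum (T : finType) (A : {set T}) (p : pred T) :
  #|[set x in A | p x]| = (\sum_(x in A) p x)%N.
Proof.
rewrite -sum1_card [RHS]big_mkcond [LHS]big_mkcond /=; apply: eq_bigr => x _.
by rewrite inE; case: (x \in A); case: (p x).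
Qed.

Lemma card_span3 (F : finFieldType) (u v w : 'rV[F]_6) (p : pred 'rV[F]_6) :
  free [:: u; v; w] ->
  #|[set y in <<[:: u; v; w]>>%VS | p y]| =
  #|[set t : F * F * F | p (t.1.1 *: u + t.1.2 *: v + t.2 *: w)]|.
Proof.
move=> fr; pose f (t : F * F * F) := t.1.1 *: u + t.1.2 *: v + t.2 *: w.
have injf : injective f by case=> -[a b] c [[a' b'] c'] /(free3_inj fr)[/= -> -> ->].
rewrite -[RHS](card_imset _ injf); congr #|pred_of_set _|; apply/setP => y.
rewrite in_set; apply/andP/imsetP => [[/mem_span3P[a [b [c ->]]] py]|[[[a b] c]]].
  by exists (a, b, c); rewrite ?inE.
by rewrite inE /= => py ->; split=> //; apply/mem_span3P; exists a, b, c.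
Qed.

(** * From counting points to counting vectors *)

Section PointCounting.

Variable F : finFieldType.
Local Notation q := #|F|.
Implicit Types (W : {vspace 'rV[F]_6}) (y : 'rV[F]_6).

Lemma card_nonzero : #|[set x : F | x != 0]| = q.-1.
Proof.
have -> : [set x : F | x != 0] = [set~ 0] by apply/setP => x; rewrite !inE.
by rewrite cardsC1.
Qed.

(** The fibres of y |-> <[y]> on nonzero vectors are the sets of nonzero multiples of one vector,
    with q - 1 elements each. *)
Lemma card_pts_vectors W (p : pred {vspace 'rV[F]_6}) :
  (#|[set P in pts W | p P]| * q.-1)%N =
  #|[set y in W | (y != 0) && p <[y]>%VS]|.
Proof.
set B := [set y in W | _]; rewrite -[RHS]sum1_card.
rewrite (partition_big (fun y : 'rV[F]_6 => <[y]>%VS)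
  [in [set P in pts W | p P]]) /=; last first.
  by move=> y; rewrite inE => /and3P[Wy y0 py]; rewrite inE mem_pts_line ?Wy.
rewrite -sum_nat_const; apply: eq_bigr => P; rewrite inE => /andP[WP pP].
have [y y0 eP] := pointP (pts_points WP).
have inj : injective (fun c : F => c *: y).
  by move=> c d /eqP; rewrite -subr_eq0 -scalerBl scaler_eq0 subr_eq0 (negPf y0) orbF => /eqP.
rewrite sum1dep_card -card_nonzero -(card_imset _ inj); congr #|pred_of_set _|.
apply/setP => z; rewrite !inE; apply/imsetP/andP.
  case=> c; rewrite inE => c0 ->; rewrite scaler_eq0 (negPf c0) (negPf y0).
  have -> : <[c *: y]>%VS = P.
    rewrite eP; apply/eqP; rewrite eqEdim !dim_vline scaler_eq0 (negPf c0) (negPf y0).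
    by rewrite leqnn -memvE memvZ ?memv_line.
  rewrite eqxx pP memvZ //; move: WP; rewrite eP mem_pts_line //.
case=> /and3P[Wz z0 _] /eqP ezP; have : z \in <[y]>%VS by rewrite -eP -ezP memv_line.
case/vlineP => c ez; exists c => //; rewrite inE; apply: contra z0 => /eqP c0.
by rewrite ez c0 scale0r.
Qed.

Lemma card_pts W : (#|pts W| * q.-1)%N = (q ^ \dim W).-1.
Proof.
have := card_pts_vectors W xpredT.
rewrite (_ : [set P in pts W | _] = pts W); last by apply/setP => P; rewrite in_set andbT.
move=> ->; have W0 := mem0v W; rewrite -card_vspace [X in _ = X.-1](cardD1 0) [_ \in _]W0 /=.
by apply: eq_card => y; rewrite !inE andbT andbC.
Qed.

Lemma card_field_gt1 : (1 < q)%N.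
Proof. by rewrite (cardD1 0) (cardD1 1) !inE oner_neq0. Qed.

Lemma card_ptsE W : #|pts W| = (\sum_(i < \dim W) q ^ i)%N.
Proof.
have q1 := card_field_gt1; apply/eqP.
by rewrite -(@eqn_pmul2r q.-1) -?subn1 ?subn_gt0 // subn1 card_pts predn_exp mulnC.
Qed.

Section CharTwo.

Hypothesis F2 : 2 \in [pchar F].

Lemma sym_mx_eq0 y : (sym_mx y == 0) = (y == 0).
Proof. by rewrite -(inj_eq (can_inj (@sym_mxK F))) linear0. Qed.

Lemma rank_sym_mx_gt0 y : (0 < \rank (sym_mx y))%N = (y != 0).
Proof. by rewrite lt0n mxrank_eq0 sym_mx_eq0. Qed.

Lemma rank3_det y : (\rank (sym_mx y) == 3) = (\det (sym_mx y) != 0).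
Proof. by rewrite -[_ == 3]/(row_free _) row_free_unit unitmxE unitfE. Qed.

Lemma veronese_nucleus (u : 'rV[F]_3) : veronese_map u \in nucleus_plane F -> u = 0.
Proof.
have [a [b [c ->]]] := row3P u; rewrite veronese_map_row3 mem_nucleus_row6.
by rewrite !sqrf_eq0 => /and3P[/eqP-> /eqP-> /eqP->]; rewrite row3_0.
Qed.

(** An alternating matrix of order 3 is singular, and it cannot have rank 1: a Veronese vector with
    zero diagonal is zero. *)
Lemma rank_nucleus y : y != 0 -> y \in nucleus_plane F -> \rank (sym_mx y) = 2.
Proof.
rewrite -rank_sym_mx_gt0 => r0 Ny; have d0 : \det (sym_mx y) = 0.
  have [a [b [c [d [e [f ey]]]]]] := row6P y; move: Ny; rewrite ey.
  rewrite mem_nucleus_row6 => /and3P[/eqP-> /eqP-> /eqP->].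
  by rewrite det_sym_mx //; ring.
have: \rank (sym_mx y) != 1.
  apply/eqP => /(rank1_veronese F2)[u eu]; move: Ny r0; rewrite eu.
  by move/veronese_nucleus ->; rewrite rank_sym_mx_gt0 -row3_0 veronese_map_row3
     !mul0r !expr0n row6_0 eqxx.
have := rank3_det y; rewrite d0 eqxx; have := rank_leq_row (sym_mx y).
by case: (\rank _) r0 => [|[|[|[|]]]].
Qed.

Lemma rank_veronese_free W y : veronese_free W -> y \in W -> \rank (sym_mx y) != 1.
Proof.
move=> fW Wy; apply/eqP => r1; have [u eu] := rank1_veronese F2 r1.
move: r1 Wy; rewrite eu => r1 /fW u0; move: r1; rewrite u0 -row3_0 veronese_map_row3.
by rewrite !mul0r !expr0n row6_0 linear0 mxrank0.
Qed.

Lemma r1_veronese_free W : veronese_free W -> r1 W = 0.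
Proof.
move=> fW; apply/eqP; rewrite cards_eq0; apply/eqP/setP => P; rewrite in_set in_set0.
apply/negP => /andP[WP]; have [y y0 eP] := pointP (pts_points WP).
move: WP; rewrite eP mem_pts_line // pt_rank_line // => Wy.
by apply/negP/(rank_veronese_free fW).
Qed.

Lemma card_pts_ranks W : #|pts W| = (r1 W + r2n W + r2s W + r3 W)%N.
Proof.
rewrite /r1 /r2n /r2s /r3.
have -> : pts W :&: pts (nucleus_plane F) =
    [set P in pts W | P \in pts (nucleus_plane F)].
  by apply/setP => P; rewrite !inE.
rewrite -sum1_card !card_set_sum -!big_split /=; apply: eq_bigr => P WP.
have [y y0 eP] := pointP (pts_points WP); rewrite eP mem_pts_line // pt_rank_line //.
have := rank_nucleus y0; case: (y \in _) => [-> //|_] /=.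
have := rank_leq_row (sym_mx y); move: y0; rewrite -rank_sym_mx_gt0.
by case: (\rank _) => [|[|[|[|]]]].
Qed.

Lemma r2n_dim W : r2n W = (\sum_(i < \dim (W :&: nucleus_plane F)) q ^ i)%N.
Proof.
rewrite -card_ptsE /r2n; congr #|pred_of_set _|; apply/setP => P.
by rewrite !inE subv_cap; case: (\dim P == 1); rewrite ?andbT.
Qed.

(** The four kinds partition the q^2 + q + 1 points of a plane, so [r2n] and [r2s] determine the
    whole distribution. *)
Lemma OD0_veronese_free W : \dim W = 3 -> veronese_free W ->
  OD0 W = [:: 0; r2n W; r2s W; q ^ 2 + q + 1 - r2n W - r2s W]%N.
Proof.
move=> dW fW; have := card_pts_ranks W; rewrite card_ptsE dW r1_veronese_free //.
rewrite !big_ord_recl big_ord0 /= /bump /= => E; rewrite /OD0 r1_veronese_free //.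
have -> : (q ^ 2 + q + 1 = r2n W + r2s W + r3 W)%N by rewrite -[RHS]E; ring.
by rewrite -subnDA addKn.
Qed.

(** Once ranks 0 and 1 are excluded, rank 2 is the vanishing of the determinant. *)
Lemma r2s_vectors W : veronese_free W -> (r2s W * q.-1)%N =
  #|[set y in W | (y \notin nucleus_plane F) && (\det (sym_mx y) == 0)]|.
Proof.
move=> fW; rewrite /r2s card_pts_vectors; congr #|pred_of_set _|; apply/setP => y.
rewrite in_set [RHS]in_set; case Wy: (y \in W) => //=.
have [->|y0] := eqVneq y 0; first by rewrite mem0v.
rewrite mem_pts_line // pt_rank_line //= andbC; congr (_ && _).
have := rank3_det y; have := rank_veronese_free fW Wy.
have := rank_leq_row (sym_mx y); move: y0; rewrite -rank_sym_mx_gt0.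
by case: (\rank _) => [|[|[|[|]]]] //= _ _ _; case: (\det _ == 0).
Qed.

End CharTwo.

End PointCounting.

(** * The families of planes that serve as normal forms *)

Section Families.

Variable F : finFieldType.
Hypothesis F2 : 2 \in [pchar F].
Implicit Types (W : {vspace 'rV[F]_6}) (a b c d e f p r u v x y z k : F).

(* The matrices [X, Z, bX + dY; Z, Y, aX + cY; bX + dY, aX + cY, 0]: the      *)
(* square root of the determinant, restricted to X = x^2 and Y = y^2, is the  *)
(* binary cubic a x^3 + b x^2 y + c x y^2 + d y^3.                            *)
Definition cubic_plane a b c d : {vspace 'rV[F]_6} :=
  <<[:: row6 1 0 b 0 a 0; row6 0 0 d 1 c 0; row6 0 1 0 0 0 0]>>%VS.

(* The matrices [X, cX + dY, Z; cX + dY, Y, aX + bY; Z, aX + bY, 0].          *)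
Definition flag_plane a b c d : {vspace 'rV[F]_6} :=
  <<[:: row6 1 c 0 0 a 0; row6 0 d 0 1 b 0; row6 0 0 1 0 0 0]>>%VS.

(** Both line planes contain [nucleus_line], the annihilator of p = (1, 0, 0). Off it, the square
    root s of the diagonal is proportional to p here and to (0, 1, 0) in [line_plane1]. The
    determinants are X^3 and Y V^2, where V is the (0, 2) entry. *)
Definition line_plane0 : {vspace 'rV[F]_6} :=
  <<[:: row6 1 0 0 0 1 0; row6 0 1 0 0 0 0; row6 0 0 1 0 0 0]>>%VS.

Definition line_plane1 : {vspace 'rV[F]_6} :=
  <<[:: row6 0 0 0 1 1 0; row6 0 1 0 0 0 0; row6 0 0 1 0 0 0]>>%VS.

Lemma free_cubic_plane a b c d :
  free [:: row6 1 0 b 0 a 0; row6 0 0 d 1 c 0; row6 0 1 0 0 0 0].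
Proof.
apply: free3P => x y z; rewrite !row6Z !row6D -row6_0 => /row6_inj[[+ + _] [+ _ _]].
by rewrite !mulr1 !mulr0 !addr0 !add0r.
Qed.

Lemma free_flag_plane a b c d :
  free [:: row6 1 c 0 0 a 0; row6 0 d 0 1 b 0; row6 0 0 1 0 0 0].
Proof.
apply: free3P => x y z; rewrite !row6Z !row6D -row6_0 => /row6_inj[[+ _ +] [+ _ _]].
by rewrite !mulr1 !mulr0 !addr0 !add0r.
Qed.

Lemma free_line_plane0 :
  free [:: row6 1 0 0 0 1 0 : 'rV[F]_6; row6 0 1 0 0 0 0; row6 0 0 1 0 0 0].
Proof.
apply: free3P => x y z; rewrite !row6Z !row6D -row6_0 => /row6_inj[[+ + +] _].
by rewrite !mulr1 !mulr0 !addr0 !add0r.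
Qed.

Lemma free_line_plane1 :
  free [:: row6 0 0 0 1 1 0 : 'rV[F]_6; row6 0 1 0 0 0 0; row6 0 0 1 0 0 0].
Proof.
apply: free3P => x y z; rewrite !row6Z !row6D -row6_0 => /row6_inj[[_ + +] [+ _ _]].
by rewrite !mulr1 !mulr0 !addr0 !add0r.
Qed.

Lemma mem_cubic_plane a b c d y0 y1 y2 y3 y4 y5 :
  (row6 y0 y1 y2 y3 y4 y5 \in cubic_plane a b c d) =
  [&& y2 == b * y0 + d * y3, y4 == a * y0 + c * y3 & y5 == 0].
Proof.
apply/mem_span3P/and3P => [[x [z [t]]]|[/eqP-> /eqP-> /eqP->]].
  rewrite !row6Z !row6D => /row6_inj[[-> _ ->] [-> -> ->]].
  by split; apply/eqP; ring.
by exists y0, y3, y1; rewrite !row6Z !row6D; congr row6; ring.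
Qed.

Lemma mem_flag_plane a b c d y0 y1 y2 y3 y4 y5 :
  (row6 y0 y1 y2 y3 y4 y5 \in flag_plane a b c d) =
  [&& y1 == c * y0 + d * y3, y4 == a * y0 + b * y3 & y5 == 0].
Proof.
apply/mem_span3P/and3P => [[x [z [t]]]|[/eqP-> /eqP-> /eqP->]].
  rewrite !row6Z !row6D => /row6_inj[[-> -> _] [-> -> ->]].
  by split; apply/eqP; ring.
by exists y0, y3, y2; rewrite !row6Z !row6D; congr row6; ring.
Qed.

Lemma mem_line_plane0 y0 y1 y2 y3 y4 y5 :
  (row6 y0 y1 y2 y3 y4 y5 \in line_plane0) = [&& y3 == 0, y4 == y0 & y5 == 0].
Proof.
apply/mem_span3P/and3P => [[x [z [t]]]|[/eqP-> /eqP-> /eqP->]].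
  rewrite !row6Z !row6D => /row6_inj[[-> _ _] [-> -> ->]].
  by split; apply/eqP; ring.
by exists y0, y1, y2; rewrite !row6Z !row6D; congr row6; ring.
Qed.

Lemma mem_line_plane1 y0 y1 y2 y3 y4 y5 :
  (row6 y0 y1 y2 y3 y4 y5 \in line_plane1) = [&& y0 == 0, y4 == y3 & y5 == 0].
Proof.
apply/mem_span3P/and3P => [[x [z [t]]]|[/eqP-> /eqP-> /eqP->]].
  rewrite !row6Z !row6D => /row6_inj[[-> _ _] [-> -> ->]].
  by split; apply/eqP; ring.
by exists y3, y1, y2; rewrite !row6Z !row6D; congr row6; ring.
Qed.

Lemma dim_cubic_plane a b c d : \dim (cubic_plane a b c d) = 3.
Proof. exact/eqP/free_cubic_plane. Qed.

Lemma dim_flag_plane a b c d : \dim (flag_plane a b c d) = 3.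
Proof. exact/eqP/free_flag_plane. Qed.

Lemma dim_line_plane0 : \dim line_plane0 = 3.
Proof. exact/eqP/free_line_plane0. Qed.

Lemma dim_line_plane1 : \dim line_plane1 = 3.
Proof. exact/eqP/free_line_plane1. Qed.

Lemma row6_neq0 y0 y1 y2 y3 y4 y5 :
  [|| y0 != 0, y1 != 0, y2 != 0, y3 != 0, y4 != 0 | y5 != 0] ->
  row6 y0 y1 y2 y3 y4 y5 != 0.
Proof.
apply: contraL => /eqP; rewrite -row6_0 => /row6_inj[[-> -> ->] [-> -> ->]].
by rewrite eqxx.
Qed.

Lemma cap_cubic_plane a b c d :
  (cubic_plane a b c d :&: nucleus_plane F)%VS = <[row6 0 1 0 0 0 0]>%VS.
Proof.
apply/vspaceP => y; have [y0 [y1 [y2 [y3 [y4 [y5 ->]]]]]] := row6P y.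
rewrite memv_cap mem_cubic_plane mem_nucleus_row6; apply/andP/vlineP => [[]|[k]].
  case/and3P => /eqP-> /eqP-> _ /and3P[/eqP-> /eqP-> /eqP->]; exists y1.
  by rewrite row6Z; congr row6; ring.
rewrite row6Z => /row6_inj[[-> _ ->] [-> -> ->]].
by rewrite !mulr0 addr0 !eqxx.
Qed.

Lemma cap_flag_plane a b c d :
  (flag_plane a b c d :&: nucleus_plane F)%VS = <[row6 0 0 1 0 0 0]>%VS.
Proof.
apply/vspaceP => y; have [y0 [y1 [y2 [y3 [y4 [y5 ->]]]]]] := row6P y.
rewrite memv_cap mem_flag_plane mem_nucleus_row6; apply/andP/vlineP => [[]|[k]].
  case/and3P => /eqP-> /eqP-> _ /and3P[/eqP-> /eqP-> /eqP->]; exists y2.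
  by rewrite row6Z; congr row6; ring.
rewrite row6Z => /row6_inj[[-> -> _] [-> -> ->]].
by rewrite !mulr0 addr0 !eqxx.
Qed.

Definition nucleus_line : {vspace 'rV[F]_6} :=
  (<[row6 0 1 0 0 0 0]> + <[row6 0 0 1 0 0 0]>)%VS.

Lemma mem_nucleus_line y0 y1 y2 y3 y4 y5 :
  (row6 y0 y1 y2 y3 y4 y5 \in nucleus_line) = [&& y0 == 0, y3 == 0, y4 == 0 & y5 == 0].
Proof.
apply/memv_addP/and4P => [[_ /vlineP[k ->] [_ /vlineP[l ->]]]|].
  by rewrite !row6Z row6D !mulr0 !addr0 => /row6_inj[[-> _ _] [-> -> ->]].
case=> /eqP-> /eqP-> /eqP-> /eqP->.
exists (y1 *: row6 0 1 0 0 0 0); first exact/memvZ/memv_line.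
exists (y2 *: row6 0 0 1 0 0 0); first exact/memvZ/memv_line.
by rewrite !row6Z row6D; congr row6; ring.
Qed.

Lemma dim_nucleus_line : \dim nucleus_line = 2.
Proof.
rewrite dimv_disjoint_sum ?dim_vline ?row6_neq0 ?oner_neq0 ?orbT //.
apply/eqP; rewrite -subv0; apply/subvP => _ /memv_capP[/vlineP[k ->] /vlineP[l]].
rewrite !row6Z => /row6_inj[[_ -> _] _].
by rewrite !mulr0 row6_0 mem0v.
Qed.

Lemma cap_line_plane0 : (line_plane0 :&: nucleus_plane F)%VS = nucleus_line.
Proof.
apply/vspaceP => y; have [y0 [y1 [y2 [y3 [y4 [y5 ->]]]]]] := row6P y.
rewrite memv_cap mem_line_plane0 mem_nucleus_row6 mem_nucleus_line.
by apply/andP/and4P => [[/and3P[-> /eqP-> ->] /and3P[-> _ _]]|[/eqP-> -> -> ->]];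
  rewrite ?eqxx.
Qed.

Lemma cap_line_plane1 : (line_plane1 :&: nucleus_plane F)%VS = nucleus_line.
Proof.
apply/vspaceP => y; have [y0 [y1 [y2 [y3 [y4 [y5 ->]]]]]] := row6P y.
rewrite memv_cap mem_line_plane1 mem_nucleus_row6 mem_nucleus_line.
by apply/andP/and4P => [[/and3P[-> /eqP-> ->] /and3P[_ -> _]]|[-> /eqP-> -> ->]];
  rewrite ?eqxx.
Qed.

Lemma veronese_free_line_plane0 : veronese_free line_plane0.
Proof.
move=> u; have [x [y [z ->]]] := row3P u; rewrite veronese_map_row3 mem_line_plane0.
rewrite !sqrf_eq0 => /and3P[/eqP-> + /eqP->]; rewrite mul0r eq_sym sqrf_eq0.
by move/eqP->; rewrite row3_0.
Qed.

Lemma veronese_free_line_plane1 : veronese_free line_plane1.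
Proof.
move=> u; have [x [y [z ->]]] := row3P u; rewrite veronese_map_row3 mem_line_plane1.
rewrite !sqrf_eq0 => /and3P[/eqP-> + /eqP z0]; rewrite z0 mulr0 eq_sym sqrf_eq0.
by move/eqP->; rewrite row3_0.
Qed.

(** A Veronese vector of the plane has last coordinate 0, and its first two satisfy a linear system
    in x^2 and y^2 with determinant [a * d + b * c]. Since all scalars are squares, this system may
    be solved freely. The square of this determinant is the discriminant of the cubic in
    characteristic 2. *)
Lemma veronese_free_cubic_plane a b c d :
  veronese_free (cubic_plane a b c d) <-> a * d + b * c != 0.
Proof.
split=> [fW | D0 u]; last first.
  have [x [y [z ->]]] := row3P u; rewrite veronese_map_row3 mem_cubic_plane sqrf_eq0.
  case/and3P => + + /eqP z0; rewrite z0 !mulr0 => /eqP E1 /eqP E2.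
  have /eqP : (a * d + b * c) * x ^+ 2 = 0.
    transitivity (d * (a * x ^+ 2 + c * y ^+ 2) + c * (b * x ^+ 2 + d * y ^+ 2));
      first by ring2.
    by rewrite -E1 -E2 !mulr0 addr0.
  have /eqP : (a * d + b * c) * y ^+ 2 = 0.
    transitivity (b * (a * x ^+ 2 + c * y ^+ 2) + a * (b * x ^+ 2 + d * y ^+ 2));
      first by ring2.
    by rewrite -E1 -E2 !mulr0 addr0.
  by rewrite !(mulf_eq0 (_ + _)) (negPf D0) !sqrf_eq0 => /eqP-> /eqP->; rewrite row3_0.
apply/eqP => D0.
have sol X Y : b * X + d * Y = 0 -> a * X + c * Y = 0 -> X = 0 /\ Y = 0.
  have [[x <-] [y <-]] := (sqrt_pchar2 F2 X, sqrt_pchar2 F2 Y).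
  move=> E1 E2; have /eqP : row3 x y 0 = 0.
    by apply: fW; rewrite veronese_map_row3 mem_cubic_plane E1 E2 !mulr0 expr0n !eqxx.
  by rewrite row3_eq0 => /and3P[/eqP-> /eqP-> _]; rewrite expr0n.
(* When the determinant vanishes, (c, a) and (d, b) solve the system, so all coefficients are 0; but
   then (1, 0) is a solution too. *)
have [||c0 a0] := sol c a; [by rewrite -[RHS]D0; ring | by ring2 |].
have [||d0 b0] := sol d b; [by ring2 | by rewrite -[RHS]D0; ring |].
have [||] := sol 1 0; rewrite ?a0 ?b0 ?mul0r ?mulr0 ?addr0 //.
by move/eqP; rewrite oner_eq0.
Qed.

Lemma veronese_free_flag_plane a b c d :
  veronese_free (flag_plane a b c d) <->
  (forall x y, a * x ^+ 2 + b * y ^+ 2 = 0 -> x * y = c * x ^+ 2 + d * y ^+ 2 ->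
     x = 0 /\ y = 0).
Proof.
split=> [fW x y E1 E2 | D0 u].
  have /eqP : row3 x y 0 = 0.
    by apply: fW; rewrite veronese_map_row3 mem_flag_plane E1 E2 !mulr0 expr0n !eqxx.
  by rewrite row3_eq0 => /and3P[/eqP-> /eqP-> _].
have [x [y [z ->]]] := row3P u; rewrite veronese_map_row3 mem_flag_plane sqrf_eq0.
case/and3P => + + /eqP z0; rewrite z0 !mulr0 => /eqP E1 /eqP E2.
by have [//|//|-> ->] := D0 x y; rewrite ?row3_0.
Qed.

(** The primed coefficients are those of lam times the cubic after x |-> p x + r y, y |-> u x + v y,
    with even multiples dropped. The plane of the original cubic is thus in the orbit of the plane
    of the new one. *)
Lemma cubic_plane_subst lam p r u v a b c d a' b' c' d' :
  lam != 0 -> p * v + r * u != 0 ->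
  a' = lam * (a * p ^+ 3 + b * p ^+ 2 * u + c * p * u ^+ 2 + d * u ^+ 3) ->
  b' = lam * (a * p ^+ 2 * r + b * p ^+ 2 * v + c * u ^+ 2 * r + d * u ^+ 2 * v) ->
  c' = lam * (a * p * r ^+ 2 + b * r ^+ 2 * u + c * p * v ^+ 2 + d * u * v ^+ 2) ->
  d' = lam * (a * r ^+ 3 + b * r ^+ 2 * v + c * r * v ^+ 2 + d * v ^+ 3) ->
  cubic_plane a b c d \in orbit 'P (Kgrp F) (cubic_plane a' b' c' d').
Proof.
(* The last diagonal entry g of the congruence absorbs both the scaling lam and the determinant of
   the substitution. *)
move=> l0 D0 ea eb ec ed; pose g := (lam * (p * v + r * u))^-1.
have lD0 : lam * (p * v + r * u) != 0 by rewrite mulf_neq0.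
have g0 : g != 0 by rewrite invr_eq0.
apply: (orbit_intro (A := mx3 p r 0 u v 0 0 0 g)).
- apply: unitmx_mx3; rewrite [X in X != 0](_ : _ = (p * v + r * u) * g); last by ring2.
  by rewrite mulf_neq0.
- by rewrite !dim_cubic_plane.
move=> y; have [y0 [y1 [y2 [y3 [y4 [y5 ->]]]]]] := row6P y.
rewrite mem_cubic_plane => /and3P[/eqP-> /eqP-> /eqP->].
rewrite cong_map_mx3 mem_cubic_plane; apply/and3P; split; apply/eqP; last by ring.
  transitivity (g * (p * (b' * y0 + d' * y3) + r * (a' * y0 + c' * y3))); first by ring.
  rewrite -[RHS](mulKf lD0); congr (_ * _); rewrite ea eb ec ed; ring2.
transitivity (g * (u * (b' * y0 + d' * y3) + v * (a' * y0 + c' * y3))); first by ring.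
rewrite -[RHS](mulKf lD0); congr (_ * _); rewrite ea eb ec ed; ring2.
Qed.

(** The upper triangular matrix used here preserves the equation [y 0 5 = 0] and the nucleus point
    of the family. The four equations compare the coefficients of [y 0 0] and [y 0 3]. *)
Lemma flag_plane_subst p r u v g a b c d a' b' c' d' :
  p != 0 -> v != 0 -> g != 0 ->
  g * v * a = a' * p ^+ 2 -> g * v * b = a' * r ^+ 2 + b' * v ^+ 2 ->
  v * (p * c + u * a) = c' * p ^+ 2 ->
  v * (p * d + r + u * b) = c' * r ^+ 2 + d' * v ^+ 2 ->
  flag_plane a' b' c' d' \in orbit 'P (Kgrp F) (flag_plane a b c d).
Proof.
move=> p0 v0 g0 ea eb ec ed.
apply: (orbit_intro (A := mx3 p r u 0 v 0 0 0 g)).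
- apply: unitmx_mx3; rewrite [X in X != 0](_ : _ = p * v * g); last by ring.
  by rewrite !mulf_neq0.
- by rewrite !dim_flag_plane.
move=> y; have [y0 [y1 [y2 [y3 [y4 [y5 ->]]]]]] := row6P y.
rewrite mem_flag_plane => /and3P[/eqP-> /eqP-> /eqP->].
rewrite cong_map_mx3 mem_flag_plane; apply/and3P; split; apply/eqP; last by ring.
  transitivity (v * (p * c + u * a) * y0 + v * (p * d + r + u * b) * y3); first by ring.
  rewrite ec ed; ring2.
transitivity (g * v * a * y0 + g * v * b * y3); first by ring.
rewrite ea eb; ring2.
Qed.

End Families.

Lemma span3_of_dim (F : fieldType) (vT : vectType F) (W : {vspace vT}) :
  \dim W = 3 -> exists u v w, W = <<[:: u; v; w]>>%VS.
Proof.
move=> dW; have := span_basis (vbasisP W); have := etrans (size_tuple (vbasis W)) dW.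
by case: (tval _) => [|u [|v [|w [|? ?]]]] // _ <-; exists u, v, w.
Qed.

(** * Planes with one nucleus point: reduction to a cubic plane or a flag plane *)

Section Reduction.

Variable F : finFieldType.
Hypothesis F2 : 2 \in [pchar F].
Implicit Types (W : {vspace 'rV[F]_6}).

(** The diagonal map on W has the one-dimensional kernel [W :&: nucleus_plane F], so its image is
    not all of F^3. Concretely, the nucleus vector is a left kernel vector of the matrix M of
    diagonals of a basis; hence M is singular and its transpose has a kernel vector too. *)
Lemma diag_functional W : \dim W = 3 -> \dim (W :&: nucleus_plane F) = 1 ->
  exists a b c : F, [|| a != 0, b != 0 | c != 0] /\
    (forall y, y \in W -> a * y 0 0 + b * y 0 3 + c * y 0 5 = 0).
Proof.
move=> dW dN; have [u [v [w eW]]] := span3_of_dim dW.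
pose n := vpick (W :&: nucleus_plane F).
have n0 : n != 0 by rewrite vpick0 -dimv_eq0 dN.
have /memv_capP[Wn Nn] : n \in (W :&: nucleus_plane F)%VS := memv_pick _.
pose M := \matrix_(i < 3, j < 3) [:: u; v; w]`_i 0 ([:: 0; 3; 5] : seq 'I_6)`_j.
have dM : \det M^T == 0.
  rewrite det_tr; move: Wn Nn n0; rewrite eW => /mem_span3P[a [b [c en]]].
  rewrite mem_nucleus_plane => /and3P[/eqP n0 /eqP n3 /eqP n5] nn0.
  apply/det0P; exists (row3 a b c).
    apply: contra nn0; rewrite row3_eq0 en => /and3P[/eqP-> /eqP-> /eqP->].
    by rewrite !scale0r !addr0.
  apply/rowP; case=> [[|[|[|j]]] hj] //;
    rewrite !mxE !big_ord_recl big_ord0 !mxE /= addr0 addrA.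
  - by rewrite -[RHS]n0 en !mxE.
  - by rewrite -[RHS]n3 en !mxE.
  - by rewrite -[RHS]n5 en !mxE.
have /det0P[z z0 zM] := dM; have [a [b [c ez]]] := row3P z.
exists a, b, c; split.
  by move: z0; rewrite ez row3_eq0 !negb_and.
have gen (i : 'I_3) (t := [:: u; v; w]`_i) : a * t 0 0 + b * t 0 3 + c * t 0 5 = 0.
  have /rowP/(_ i) := zM; rewrite ez !mxE !big_ord_recl big_ord0 !mxE /= addr0 addrA.
  by [].
move=> y; rewrite eW => /mem_span3P[k [l [m ->]]].
have [E0 E1 E2] := And3 (gen 0) (gen 1) (gen 2); rewrite /= in E0 E1 E2.
rewrite !mxE.
transitivity (k * (a * u 0 0 + b * u 0 3 + c * u 0 5)
  + l * (a * v 0 0 + b * v 0 3 + c * v 0 5)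
  + m * (a * w 0 0 + b * w 0 3 + c * w 0 5)); first by ring.
by rewrite E0 E1 E2 !mulr0 !addr0.
Qed.

Lemma unitmx_last_row (x y z : F) : [|| x != 0, y != 0 | z != 0] ->
  exists a b c d e f, mx3 a b c d e f x y z \in unitmx.
Proof.
have [x0|x0 _] := eqVneq x 0; last first.
  exists 0, 1, 0, 0, 0, 1; apply: unitmx_mx3.
  by rewrite (_ : _ - _ + _ = x) //; ring.
have [y0|y0 _] := eqVneq y 0; last first.
  exists 1, 0, 0, 0, 0, 1; apply: unitmx_mx3.
  by rewrite (_ : _ - _ + _ = - y) ?oppr_eq0 //; ring.
move=> /= z0; exists 1, 0, 0, 0, 1, 0; apply: unitmx_mx3.
by rewrite (_ : _ - _ + _ = z) //; ring.
Qed.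

(** The last diagonal entry of A M A^T is the diagonal of M weighted by the squares of the last row
    of A. Taking for that row the square roots of the relation given by [diag_functional] makes this
    entry vanish. *)
Lemma orbit_last_coord0 W : \dim W = 3 -> \dim (W :&: nucleus_plane F) = 1 ->
  exists2 W', W' \in orbit 'P (Kgrp F) W & forall y, y \in W' -> y 0 5 = 0.
Proof.
move=> dW dN; have [x [y [z [xyz0 W0]]]] := diag_functional dW dN.
have [[a ea] [b eb] [c ec]] := And3 (sqrt_pchar2 F2 x) (sqrt_pchar2 F2 y) (sqrt_pchar2 F2 z).
have abc0 : [|| a != 0, b != 0 | c != 0].
  by move: xyz0; rewrite -ea -eb -ec !sqrf_eq0.
have [m0 [m1 [m2 [m3 [m4 [m5 uM]]]]]] := unitmx_last_row abc0.
eexists; first exact: (orbit_cong W uM).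
move=> _ /cong_vspaceP[t /W0 + ->]; rewrite [t]row6_eta cong_map_mx3 !row6E.
rewrite -ea -eb -ec => E; rewrite -[RHS]E; ring2.
Qed.

Lemma orbit_dim W W' : W' \in orbit 'P (Kgrp F) W -> \dim W' = \dim W.
Proof. by case/orbit_congP => A uA ->; rewrite dim_cong. Qed.

Lemma orbit_cap W W' : W' \in orbit 'P (Kgrp F) W ->
  (W' :&: nucleus_plane F)%VS \in orbit 'P (Kgrp F) (W :&: nucleus_plane F)%VS.
Proof. by case/orbit_congP => A uA ->; rewrite cong_cap_nucleus // orbit_cong. Qed.

Lemma orbit_veronese_free W W' : W' \in orbit 'P (Kgrp F) W ->
  veronese_free W -> veronese_free W'.
Proof. by case/orbit_congP => A uA ->; apply: veronese_free_cong. Qed.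

Lemma point_cap W : \dim (W :&: nucleus_plane F) = 1 ->
  exists2 n, n != 0 & (W :&: nucleus_plane F)%VS = <[n]>%VS.
Proof. by move=> dN; apply: pointP; rewrite inE dN. Qed.

(** By rank-nullity: the map to the first two diagonal entries has a one-dimensional kernel on W,
    hence is onto. *)
Lemma diag_section W : \dim W = 3 -> \dim (W :&: nucleus_plane F) = 1 ->
  (forall y, y \in W -> y 0 5 = 0) ->
  forall x y : F, exists y1 y2 y4, row6 x y1 y2 y y4 0 \in W.
Proof.
move=> dW dN W5 x y.
have lpr : linear (fun t : 'rV[F]_6 => \row_j [:: t 0 0; t 0 3]`_j : 'rV[F]_2).
  by move=> k s t; apply/rowP; case=> [[|[|j]] hj] //; rewrite !mxE.
pose Lpr := GRing.isLinear.Build F 'rV[F]_6 'rV[F]_2 _ _ lpr.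
pose pr : {linear 'rV[F]_6 -> 'rV[F]_2} := HB.pack
  (fun t : 'rV[F]_6 => \row_j [:: t 0 0; t 0 3]`_j : 'rV[F]_2) Lpr.
have eqN : (W :&: lker (linfun pr))%VS = (W :&: nucleus_plane F)%VS.
  apply/vspaceP => t; rewrite memv_cap memv_ker lfunE [RHS]memv_cap mem_nucleus_plane.
  case Wt: (t \in W) => //=; rewrite (W5 _ Wt) eqxx andbT.
  apply/eqP/andP => [/rowP E|[/eqP E0 /eqP E3]].
    by have := E 0; have := E 1; rewrite !mxE /= => -> ->; rewrite eqxx.
  by apply/rowP; case=> [[|[|j]] hj] //; rewrite !mxE /= ?E0 ?E3.
have full : (linfun pr @: W)%VS = fullv.
  apply/eqP; rewrite eqEdim subvf dimvf.
  by have := limg_ker_dim (linfun pr) W; rewrite eqN dN dW add1n => -[->].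
have : \row_j [:: x; y]`_j \in (linfun pr @: W)%VS by rewrite full memvf.
case/memv_imgP => t Wt; rewrite lfunE => /rowP E.
exists (t 0 1), (t 0 2), (t 0 4).
by have := E 0; have := E 1; rewrite !mxE /= -(W5 _ Wt) => -> ->; rewrite -row6_eta.
Qed.

Lemma eq_cubic_plane W : \dim W = 3 ->
  (W :&: nucleus_plane F)%VS = <[row6 0 1 0 0 0 0]>%VS ->
  (forall y, y \in W -> y 0 5 = 0) -> exists a b c d, W = cubic_plane a b c d.
Proof.
move=> dW cN W5.
have dN : \dim (W :&: nucleus_plane F) = 1.
  by rewrite cN dim_vline row6_neq0 ?oner_neq0 ?orbT.
have [z1 [b [a W1]]] := diag_section dW dN W5 1 0.
have [z2 [d [c W2]]] := diag_section dW dN W5 0 1.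
have Wn : row6 0 1 0 0 0 0 \in W.
  by have /memv_capP[] : row6 0 1 0 0 0 0 \in (W :&: nucleus_plane F)%VS
    by rewrite cN memv_line.
exists a, b, c, d; apply/esym/eqP; rewrite eqEdim dim_cubic_plane dW leqnn andbT.
apply/subvP => y; have [y0 [y1 [y2 [y3 [y4 [y5 ->]]]]]] := row6P y.
rewrite mem_cubic_plane => /and3P[/eqP-> /eqP-> /eqP->].
have eq_mem_W s t : s \in W -> s = t -> t \in W by move=> ? <-.
apply: (eq_mem_W _ _ (memvD (memvD (memvZ y0 W1) (memvZ y3 W2)) (memvZ (y1 - y0 * z1 - y3 * z2) Wn))).
rewrite !row6Z !row6D; congr row6; ring.
Qed.

Lemma eq_flag_plane W : \dim W = 3 ->
  (W :&: nucleus_plane F)%VS = <[row6 0 0 1 0 0 0]>%VS ->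
  (forall y, y \in W -> y 0 5 = 0) -> exists a b c d, W = flag_plane a b c d.
Proof.
move=> dW cN W5.
have dN : \dim (W :&: nucleus_plane F) = 1.
  by rewrite cN dim_vline row6_neq0 ?oner_neq0 ?orbT.
have [c [z1 [a W1]]] := diag_section dW dN W5 1 0.
have [d [z2 [b W2]]] := diag_section dW dN W5 0 1.
have Wn : row6 0 0 1 0 0 0 \in W.
  by have /memv_capP[] : row6 0 0 1 0 0 0 \in (W :&: nucleus_plane F)%VS
    by rewrite cN memv_line.
exists a, b, c, d; apply/esym/eqP; rewrite eqEdim dim_flag_plane dW leqnn andbT.
apply/subvP => y; have [y0 [y1 [y2 [y3 [y4 [y5 ->]]]]]] := row6P y.
rewrite mem_flag_plane => /and3P[/eqP-> /eqP-> /eqP->].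
have eq_mem_W s t : s \in W -> s = t -> t \in W by move=> ? <-.
apply: (eq_mem_W _ _ (memvD (memvD (memvZ y0 W1) (memvZ y3 W2)) (memvZ (y2 - y0 * z1 - y3 * z2) Wn))).
rewrite !row6Z !row6D; congr row6; ring.
Qed.

Lemma vline_scale (vT : vectType F) (k : F) (v : vT) : k != 0 -> <[k *: v]>%VS = <[v]>%VS.
Proof.
move=> k0; apply/eqP; rewrite eqEdim !dim_vline scaler_eq0 (negPf k0) leqnn andbT.
by rewrite -memvE memvZ ?memv_line.
Qed.

(* The last row (0, 0, 1) preserves the equation y 0 5 = 0 obtained before;    *)
(* the upper left block moves the last column (q, r) to (1, 0).               *)
Lemma unitmx_nucleus_flag (p q r : F) : (q != 0) || (r != 0) ->
  exists a b c d e f, mx3 a b c d e f 0 0 1 \in unitmx /\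
    cong_map (mx3 a b c d e f 0 0 1) (row6 0 p q 0 r 0) = row6 0 0 1 0 0 0.
Proof.
have [->|q0 _] := eqVneq q 0; last first.
  exists q^-1, 0, 0, r, q, p; split.
    apply: unitmx_mx3; rewrite (_ : _ - _ + _ = q^-1 * q); last by ring.
    by rewrite mulVf // oner_neq0.
  rewrite cong_map_mx3; congr row6; try ring2; rewrite -[RHS](mulVf q0); ring2.
move=> /= r0; exists 0, r^-1, 0, 1, 0, (p * r^-1); split.
  apply: unitmx_mx3; rewrite (_ : _ - _ + _ = - r^-1) ?oppr_eq0 ?invr_eq0 //; ring.
rewrite cong_map_mx3; congr row6; try ring2; last first.
  by rewrite -[RHS](mulVf r0); ring2.
transitivity (r^-1 * p * (1 + r^-1 * r)); first by ring2.
by rewrite mulVf // [1 + 1](pcharf0 F2) mulr0.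
Qed.

(** Once the last diagonal entry vanishes, the nucleus point has off-diagonal entries p, q, r. It is
    fixed by the choice of that entry exactly when q = r = 0, the cubic case; otherwise
    [unitmx_nucleus_flag] moves it to the nucleus point of the flag planes. *)
Lemma point_plane_reduction W :
  \dim W = 3 -> \dim (W :&: nucleus_plane F) = 1 ->
  exists a b c d, cubic_plane a b c d \in orbit 'P (Kgrp F) W \/
                  flag_plane a b c d \in orbit 'P (Kgrp F) W.
Proof.
move=> dW dN; have [V oV V5] := orbit_last_coord0 dW dN.
have dV : \dim V = 3 by rewrite (orbit_dim oV).
have dVN : \dim (V :&: nucleus_plane F) = 1 by rewrite (orbit_dim (orbit_cap oV)).
have [n n0 cN] := point_cap dVN.
have : n \in (V :&: nucleus_plane F)%VS by rewrite cN memv_line.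
have [y0 [p [q [y3 [r [y5 en]]]]]] := row6P n; move: n0 cN; rewrite en.
move=> n0 cN; rewrite memv_cap mem_nucleus_row6 => /andP[_ /and3P[/eqP e0 /eqP e3 /eqP e5]].
move: n0 cN; rewrite {}e0 {}e3 {}e5 => n0 cN.
have [/orP qr0|] := boolP ((q != 0) || (r != 0)).
  have [a [b [c [d [e [f [uA An]]]]]]] := unitmx_nucleus_flag p (introT orP qr0).
  set A := mx3 _ _ _ _ _ _ _ _ _ in uA An.
  have [||y|a' [b' [c' [d' eV]]]] := @eq_flag_plane (cong_vspace A V).
  - by rewrite dim_cong.
  - by rewrite cong_cap_nucleus // cN cong_line An.
  - case/cong_vspaceP => z /V5 z5 ->; rewrite [z]row6_eta z5 cong_map_mx3 row6E; ring.
  exists a', b', c', d'; right; rewrite -eV.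
  exact: orbit_trans (orbit_cong V uA) oV.
rewrite negb_or !negbK => /andP[/eqP q0 /eqP r0].
have [|a [b [c [d eV]]]] := eq_cubic_plane dV _ V5.
  rewrite cN q0 r0; have p0 : p != 0.
    by move: n0; rewrite q0 r0; apply: contra => /eqP->; rewrite row6_0.
  rewrite -[RHS](vline_scale _ p0) row6Z.
  by rewrite !mulr0 mulr1.
by exists a, b, c, d; left; rewrite -eV.
Qed.

End Reduction.

(** * Planes meeting the nucleus plane in a line *)

Section LineReduction.

Variable F : finFieldType.
Hypothesis F2 : 2 \in [pchar F].
Implicit Types (W : {vspace 'rV[F]_6}).

Lemma span_row6_line (X Y Z E : F) : [|| X != 0, Y != 0 | Z != 0] ->
  \dim <<[:: row6 X 0 0 Y E Z; row6 0 1 0 0 0 0; row6 0 0 1 0 0 0]>> = 3.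
Proof.
move=> XYZ0; apply/eqP/free3P => k l m; rewrite !row6Z !row6D -row6_0.
move=> /row6_inj[[/eqP e0 e1 e2] [/eqP e3 _ /eqP e5]].
move: e0 e3 e5 e1 e2; rewrite !mulr0 !addr0 !mulr1 !add0r !mulf_eq0.
by case: (k =P 0) XYZ0 => //= _ /or3P[] /negPf->.
Qed.

(** Let s = (x, y, z) be the square root of the diagonal of the generator outside the line. If y or
    z is nonzero, a matrix fixing (1, 0, 0) sends s to a multiple of (0, 1, 0), which gives
    [line_plane1]; if y = z = 0, a diagonal scaling gives [line_plane0]. *)
Lemma line_plane_normal_form (X Y Z E : F)
    (V := <<[:: row6 X 0 0 Y E Z; row6 0 1 0 0 0 0; row6 0 0 1 0 0 0]>>%VS) :
  [|| X != 0, Y != 0 | Z != 0] -> veronese_free V ->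
  line_plane0 F \in orbit 'P (Kgrp F) V \/ line_plane1 F \in orbit 'P (Kgrp F) V.
Proof.
move=> XYZ0 fV; have dV : \dim V = 3 := span_row6_line E XYZ0.
have [[x ex] [y ey] [z ez]] := And3 (sqrt_pchar2 F2 X) (sqrt_pchar2 F2 Y) (sqrt_pchar2 F2 Z).
have Vin k l m : row6 (k * X) l m (k * Y) (k * E) (k * Z) \in V.
  by apply/mem_span3P; exists k, l, m; rewrite !row6Z !row6D; congr row6; ring.
(* If E = y z, correcting the generator along the nucleus line would give the Veronese vector of (x,
   y, z). *)
have E0 : E + y * z != 0.
  rewrite addr_eq0_pchar2 //; apply/eqP => eE.
  have u0 : row3 x y z == 0.
    by apply/eqP/fV; rewrite veronese_map_row3 ex ey ez -eE; have := Vin 1 (x * y) (x * z);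
      rewrite !mul1r.
  move: u0 XYZ0; rewrite row3_eq0 -ex -ey -ez !sqrf_eq0.
  by case/and3P=> -> -> ->.
have inV W (A : 'M_3) : A \in unitmx -> \dim W = 3 ->
    (forall k l m, cong_map A (row6 (k * X) l m (k * Y) (k * E) (k * Z)) \in W) ->
    W \in orbit 'P (Kgrp F) V.
  move=> uA dW sW; apply: (orbit_intro uA); first by rewrite dW dV.
  move=> _ /mem_span3P[k [l [m ->]]].
  rewrite (_ : _ + _ = row6 (k * X) l m (k * Y) (k * E) (k * Z)) //.
  by rewrite !row6Z !row6D; congr row6; ring.
have [y0|y0] := eqVneq y 0; last first.
  (* This matrix sends (x, y, z) to (0, E + y z, 0); the factor (E + y z) / y is chosen so that the
     new (1, 2) entry equals the new (1, 1) entry. *)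
  right; apply: (inV _ (mx3 1 (x / y) 0 0 ((E + y * z) / y) 0 0 z y)) => [||k l m].
  - apply: unitmx_mx3; rewrite (_ : _ - _ + _ = (E + y * z) / y * y); last by ring.
    by rewrite divfK.
  - exact: dim_line_plane1.
  rewrite cong_map_mx3 mem_line_plane1 -ex -ey -ez; apply/and3P; split; apply/eqP.
  - transitivity (k * (x ^+ 2 + (x / y * y) ^+ 2)); first by ring2.
    rewrite divfK //; ring2.
  - transitivity (k * ((E + y * z) / y * y) * (E + y * z)); first by ring2.
    transitivity (k * ((E + y * z) / y * y) ^+ 2); last by ring2.
    by rewrite divfK //; ring.
  - ring2.
rewrite {}y0 mul0r addr0 in ey E0.
have [z0|z0] := eqVneq z 0; last first.
  right; apply: (inV _ (mx3 1 0 (x / z) 0 0 (E / z) 0 z 0)) => [||k l m].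
  - apply: unitmx_mx3; rewrite (_ : _ - _ + _ = - (E / z * z)); last by ring.
    by rewrite divfK // oppr_eq0.
  - exact: dim_line_plane1.
  rewrite cong_map_mx3 mem_line_plane1 -ex -ey -ez; apply/and3P; split; apply/eqP.
  - transitivity (k * (x ^+ 2 + (x / z * z) ^+ 2)); first by ring2.
    rewrite divfK //; ring2.
  - transitivity (k * (E / z * z) * E); first by ring2.
    transitivity (k * (E / z * z) ^+ 2); last by ring2.
    by rewrite divfK //; ring.
  - ring2.
left; have X0 : X != 0.
  by move: XYZ0; rewrite -ey -ez z0 expr0n eqxx !orbF.
apply: (inV _ (mx3 1 0 0 0 (X / E) 0 0 0 1)) => [||k l m].
- apply: unitmx_mx3; rewrite (_ : _ - _ + _ = X / E); last by ring.
  by rewrite mulf_neq0 ?invr_eq0.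
- exact: dim_line_plane0.
rewrite cong_map_mx3 mem_line_plane0 -ey -ez z0; apply/and3P; split; apply/eqP.
- ring2.
- transitivity (k * (X / E * E)); first by ring2.
  by rewrite divfK //; ring.
- ring2.
Qed.

(** By [o12_1_orbit] the intersection can be moved to [nucleus_line]; a further vector of the plane,
    cleared of its component along this line, then generates the plane together with it. *)
Lemma line_plane_reduction W :
  \dim W = 3 -> veronese_free W -> (W :&: nucleus_plane F)%VS \in o12_1 F ->
  line_plane0 F \in orbit 'P (Kgrp F) W \/ line_plane1 F \in orbit 'P (Kgrp F) W.
Proof.
move=> dW fW oW; have : nucleus_line F \in o12_1 F.
  rewrite !inE dim_nucleus_line eqxx; apply/subvP => y.
  have [y0 [y1 [y2 [y3 [y4 [y5 ->]]]]]] := row6P y.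
  by rewrite mem_nucleus_line mem_nucleus_row6 => /and4P[-> -> _ ->].
rewrite -(o12_1_orbit F2 oW) => /orbit_congP[A uA eN].
pose V := cong_vspace A W; have oV : V \in orbit 'P (Kgrp F) W := orbit_cong W uA.
have dV : \dim V = 3 by rewrite dim_cong.
have cV : (V :&: nucleus_plane F)%VS = nucleus_line F by rewrite cong_cap_nucleus // -eN.
have fV : veronese_free V := veronese_free_cong uA fW.
have /subvPn[t Vt] : ~~ (V <= nucleus_plane F)%VS.
  by apply/negP => /capv_idPl e; have := dim_nucleus_line F; rewrite -cV e dV.
have sN y0 y1 y2 y3 y4 y5 :
    [&& y0 == 0, y3 == 0, y4 == 0 & y5 == 0] -> row6 y0 y1 y2 y3 y4 y5 \in V.
  by rewrite -(@mem_nucleus_line F y0 y1 y2) -cV => /memv_capP[].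
have [X [p [q [Y [E [Z et]]]]]] := row6P t; move: Vt; rewrite {t}et => Vt.
rewrite mem_nucleus_row6 !negb_and => XYZ0.
have V0 : row6 X 0 0 Y E Z \in V.
  rewrite (_ : row6 X 0 0 Y E Z = row6 X p q Y E Z + row6 0 (- p) (- q) 0 0 0).
    by rewrite memvD // sN // eqxx.
  by rewrite row6D; congr row6; ring.
have eV : V = <<[:: row6 X 0 0 Y E Z; row6 0 1 0 0 0 0; row6 0 0 1 0 0 0]>>%VS.
  apply/esym/eqP; rewrite eqEdim dV; apply/andP; split.
    apply/subvP => _ /mem_span3P[k [l [m ->]]].
    by rewrite !memvD ?memvZ // sN // eqxx.
  by rewrite span_row6_line.
have := @line_plane_normal_form X Y Z E XYZ0; rewrite -eV => /(_ fV).
by case=> oL; [left | right]; apply: orbit_trans oL oV.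
Qed.

End LineReduction.

(** * The image of t |-> t^2 + t *)

Section ArtinSchreier.

Variable F : finFieldType.
Hypothesis F2 : 2 \in [pchar F].

Lemma nonsurj_of_collision (f : F -> F) x y : x != y -> f x = f y ->
  exists z, forall t, f t != z.
Proof.
move=> xy fxy; have [/forallP onto|] := boolP [forall z, [exists t, f t == z]].
  have injf : injective f.
    have imF : [set f t | t in F] = setT.
      apply/setP => z; rewrite inE; apply/imsetP.
      by have /existsP[t /eqP <-] := onto z; exists t.
    have : #|[set f t | t in F]| == #|F| by rewrite imF cardsT.
    by move/imset_injP => inj s t; apply: inj.
  by case/eqP: xy; apply: injf.
rewrite negb_forall => /existsP[z]; rewrite negb_exists => /forallP fz.
by exists z.
Qed.

Lemma artin_schreier_nonsurj : exists d : F, forall t, t ^+ 2 + t != d.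
Proof.
apply: (@nonsurj_of_collision (fun t => t ^+ 2 + t) 0 1); first by rewrite eq_sym oner_neq0.
by rewrite expr0n expr1n add0r [RHS](pcharf0 F2).
Qed.

(* t |-> t^2 + t is additive with kernel {0, 1}: its image has index 2.        *)
Lemma artin_schreier_index2 (d e : F) :
  (forall t, t ^+ 2 + t != d) -> (forall t, t ^+ 2 + t != e) ->
  exists t, t ^+ 2 + t = d + e.
Proof.
move=> dI eI; pose wp (t : F) := t ^+ 2 + t; pose I := [set wp t | t in F].
have wpD s t : wp (s + t) = wp s + wp t by rewrite /wp; ring2.
have cardI : (#|F| <= #|I| * 2)%N.
  (* The fibres of [wp] are the pairs {t, t + 1}; the bit b tells the two members apart by their
     rank in the enumeration, so ([wp], b) is injective and the image has at least q / 2
     elements. *)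
  pose b (t : F) := (enum_rank t < enum_rank (t + 1)%R)%N.
  pose g t := (wp t, b t).
  have addK1 (t : F) : t + 1 + 1 = t by ring2.
  have injg : injective g.
    move=> s t [/eqP + bst].
    rewrite -(addr_eq0_pchar2 _ _ F2) -wpD (_ : wp _ = (s + t) * (s + t + 1)); last first.
      by rewrite /wp; ring.
    rewrite mulf_eq0 -addrA !(addr_eq0_pchar2 _ _ F2) => /orP[/eqP //|/eqP est].
    move: bst; rewrite /b est addK1; case: ltngtP => // /val_inj/enum_rank_inj.
    by move/eqP; rewrite -subr_eq0 (addrC t) addrK oner_eq0.
  rewrite -(card_imset predT injg) -card_bool -cardsT -cardsX.
  apply/subset_leq_card/subsetP => _ /imsetP[t _ ->].
  by rewrite !inE andbT; apply: imset_f.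
(* The coset of d is disjoint from the image and has the same size, so together they fill F; hence e
   lies in that coset. *)
pose J := [set d + x | x in I].
have cardJ : #|J| = #|I| by apply/card_imset/addrI.
have IJ0 : I :&: J = set0.
  apply/setP => x; rewrite !inE; apply/negP => /andP[/imsetP[s _ ->] /imsetP[_ /imsetP[t _ ->] E]].
  have := dI (s + t); rewrite -/(wp _) wpD E => /eqP; apply; ring2.
have /setP/(_ e) : I :|: J = setT.
  apply/eqP; rewrite eqEcard subsetT cardsT cardsU IJ0 cards0 subn0 cardJ.
  by rewrite addnn -muln2.
rewrite !inE => /orP[/imsetP[t _ et]|/imsetP[_ /imsetP[t _ ->] ->]].
  by have := eI t; rewrite et eqxx.
by exists t; rewrite -/(wp t); ring2.
Qed.

End ArtinSchreier.

(** * The three normal forms of flag planes *)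

Section FlagNormalForms.

Variable F : finFieldType.
Hypothesis F2 : 2 \in [pchar F].
Variable delta : F.
Hypothesis deltaP : forall t, t ^+ 2 + t != delta.

(** The three cases are a != 0, then a = 0 with b != 0, then a = b = 0. In the last one only the
    class of c d modulo the elements t^2 + t matters, and there is a single nontrivial class. *)
Lemma flag_plane_normal_form (a b c d : F) : veronese_free (flag_plane a b c d) ->
  [\/ flag_plane 1 0 0 1 \in orbit 'P (Kgrp F) (flag_plane a b c d),
      flag_plane 0 1 1 0 \in orbit 'P (Kgrp F) (flag_plane a b c d)
    | flag_plane 0 0 1 delta \in orbit 'P (Kgrp F) (flag_plane a b c d)].
Proof.
move/veronese_free_flag_plane => fW.
have [a0|a0] := eqVneq a 0; last first.
  constructor 1; have [s es] := sqrt_pchar2 F2 (b / a).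
  have eb : b = a * s ^+ 2 by rewrite es mulrC divfK.
  (* v = 0 would make (s, 1) satisfy both Veronese equations, a s^2 + b = 0 and s = c s^2 + d. *)
  pose v := d + s + c * s ^+ 2.
  have v0 : v != 0.
    apply/eqP => ev; have [] := fW s 1; first by rewrite eb; ring2.
      by apply: (pchar2_eq F2); rewrite -[RHS]ev /v; ring.
    by move=> _ /eqP; rewrite oner_eq0.
  apply: (flag_plane_subst F2 (p := 1) (r := s) (u := c / a) (v := v) (g := (v * a)^-1)).
  - exact: oner_neq0.
  - exact: v0.
  - by rewrite invr_eq0 mulf_neq0.
  - by rewrite -mulrA mulVf ?mulf_neq0 //; ring.
  - transitivity ((v * a)^-1 * (v * a) * s ^+ 2); first by rewrite eb; ring.
    by rewrite mulVf ?mulf_neq0 //; ring.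
  - by rewrite divfK //; ring2.
  - rewrite eb; transitivity (v * (d + s + (c / a * a) * s ^+ 2)); first by ring.
    by rewrite divfK // -/v; ring.
rewrite {}a0 in fW *.
have c0 : b = 0 \/ b != 0 -> c != 0.
  move=> _; apply/eqP => c0; have [||/eqP] := fW 1 0; try by rewrite ?c0; ring.
  by rewrite oner_eq0.
have [b0|b0] := eqVneq b 0; last first.
  constructor 2; have {}c0 : c != 0 by apply: c0; right.
  apply: (flag_plane_subst F2 (p := c) (r := 0) (u := c * d / b) (v := 1) (g := b^-1)).
  - exact: c0.
  - exact: oner_neq0.
  - by rewrite invr_eq0.
  - ring.
  - by rewrite mulr1 mulVf //; ring.
  - ring.
  - by rewrite divfK //; ring2.
constructor 3; have {}c0 : c != 0 by apply: c0; left.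
rewrite {}b0 in fW *.
(* With y = 1 and t = c x, the Veronese equation x = c x^2 + d reads t^2 + t = c d, so c d is not of
   this form, and c d + delta is. *)
have [|r er] := artin_schreier_index2 F2 (d := c * d) _ deltaP.
  move=> t; apply/eqP => et; have [||_ /eqP] := fW (t / c) 1; first by ring.
    apply: (mulfI c0); transitivity (t / c * c); first by ring.
    transitivity ((t / c * c) ^+ 2 + c * d); last by ring.
    by rewrite divfK // -et; ring2.
  by rewrite oner_eq0.
apply: (flag_plane_subst F2 (p := c) (r := r) (u := 0) (v := 1) (g := 1)).
- exact: c0.
- exact: oner_neq0.
- exact: oner_neq0.
- ring.
- ring.
- ring.
- transitivity (r + (c * d + delta) + delta); first by ring2.
  by rewrite -er; ring2.
Qed.

End FlagNormalForms.

(** * Binary cubics of nonzero discriminant up to substitution and scaling *)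

Section CubicNormalForms.

Variable F : finFieldType.
Hypothesis F2 : 2 \in [pchar F].

Definition binary_cubic (a b c d x y : F) : F :=
  a * x ^+ 3 + b * x ^+ 2 * y + c * x * y ^+ 2 + d * y ^+ 3.

Lemma cubic_plane_veronese_free_orbit (a b c d a' b' c' d' : F) :
  cubic_plane a' b' c' d' \in orbit 'P (Kgrp F) (cubic_plane a b c d) ->
  a * d + b * c != 0 -> a' * d' + b' * c' != 0.
Proof.
move=> o /(veronese_free_cubic_plane F2)/(orbit_veronese_free o).
by move/(veronese_free_cubic_plane F2).
Qed.

(** Sending the root to (1, 0) kills a; the discriminant then makes b and c nonzero, and they scale
    to 1. What remains is x^2 y + x y^2 + e y^3, where only the class of e modulo the elements t^2 +
    t matters. *)
Lemma cubic_plane_root_normal_form (delta a b c d x y : F) :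
  (forall t, t ^+ 2 + t != delta) -> a * d + b * c != 0 ->
  (x != 0) || (y != 0) -> binary_cubic a b c d x y = 0 ->
  cubic_plane 0 1 1 0 \in orbit 'P (Kgrp F) (cubic_plane a b c d) \/
  cubic_plane 0 1 1 delta \in orbit 'P (Kgrp F) (cubic_plane a b c d).
Proof.
move=> deltaP D0 xy0 fxy.
have [b1 [c1 [d1 o1]]] : exists b1 c1 d1,
    cubic_plane 0 b1 c1 d1 \in orbit 'P (Kgrp F) (cubic_plane a b c d).
  have [ex|x0] := eqVneq x 0.
    do 3!eexists; rewrite orbit_sym.
    apply: (cubic_plane_subst F2 (lam := 1) (p := x) (u := y) (r := 1) (v := 0)) => //.
    - exact: oner_neq0.
    - by move: xy0; rewrite ex eqxx mulr0 add0r mul1r.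
    - by rewrite -[LHS]fxy /binary_cubic mul1r.
  do 3!eexists; rewrite orbit_sym.
  apply: (cubic_plane_subst F2 (lam := 1) (p := x) (u := y) (r := 0) (v := 1)) => //.
  - exact: oner_neq0.
  - by rewrite mul0r mulr1 addr0.
  - by rewrite -[LHS]fxy /binary_cubic mul1r.
have := cubic_plane_veronese_free_orbit o1 D0.
rewrite mul0r add0r mulf_eq0 negb_or => /andP[b0 c0].
have o2 : cubic_plane 0 1 1 (d1 * b1 / c1 ^+ 2) \in
    orbit 'P (Kgrp F) (cubic_plane a b c d).
  apply: orbit_trans o1; rewrite orbit_sym.
  have bc0 : b1 ^+ 2 * c1 ^+ 2 != 0 by rewrite mulf_neq0 ?expf_neq0.
  apply: (cubic_plane_subst F2 (lam := (b1 ^+ 2 * c1 ^+ 2)^-1)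
     (p := c1) (u := 0) (r := 0) (v := b1)).
  - by rewrite invr_eq0.
  - by rewrite mulr0 addr0 mulf_neq0.
  - ring.
  - by rewrite -[LHS](mulVf bc0); ring.
  - by rewrite -[LHS](mulVf bc0); ring.
  - apply: (mulfI bc0); rewrite [RHS]mulrA divff // mul1r.
    transitivity (b1 ^+ 3 * d1 * (c1 ^+ 2 / c1 ^+ 2)); first by ring.
    by rewrite divff ?expf_neq0 //; ring.
move: o2; set e := d1 * b1 / _ => o2.
(* The substitution x |-> x + t y leaves x^2 y + x y^2 + e y^3 unchanged except for adding t^2 + t
   to e. *)
have shift t : cubic_plane 0 1 1 (e + (t ^+ 2 + t)) \in
    orbit 'P (Kgrp F) (cubic_plane a b c d).
  apply: orbit_trans o2; rewrite orbit_sym.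
  apply: (cubic_plane_subst F2 (lam := 1) (p := 1) (u := 0) (r := t) (v := 1)); try ring.
    exact: oner_neq0.
  by rewrite mulr0 mulr1 addr0 oner_neq0.
have [/existsP[t /eqP et]|] := boolP [exists t : F, t ^+ 2 + t == e].
  by left; move: (shift t); rewrite et [e + e](_ : _ = 0) //; ring2.
rewrite negb_exists => /forallP eP; right.
have [t et] := artin_schreier_index2 F2 eP deltaP.
move: (shift t); rewrite et [e + (e + delta)](_ : _ = delta) //; ring2.
Qed.

Definition rootless (a b c d : F) :=
  forall x y, binary_cubic a b c d x y = 0 -> x = 0 /\ y = 0.

Lemma rootless_lead (a b c d : F) : rootless a b c d -> a != 0.
Proof.
move=> rf; apply/eqP => a0; have [|/eqP] := rf 1 0; first by rewrite /binary_cubic a0; ring.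
by rewrite oner_eq0.
Qed.

Definition cubic_poly (a b c d : F) : {poly F} := Poly [:: d; c; b; a].

Lemma size_cubic_poly a b c d : a != 0 -> size (cubic_poly a b c d) = 4.
Proof. by move=> a0; rewrite (PolyK (c := 0)). Qed.

Lemma horner_cubic_poly (L : fieldExtType F) a b c d (t : L) :
  (map_poly (in_alg L) (cubic_poly a b c d)).[t] =
  a%:A * t ^+ 3 + b%:A * t ^+ 2 + c%:A * t + d%:A.
Proof.
rewrite map_Poly_id0 ?rmorph0 // horner_Poly /=; ring.
Qed.

Lemma irreducible_rootless a b c d : rootless a b c d ->
  irreducible_poly (cubic_poly a b c d).
Proof.
move=> rf; apply: cubic_irreducible.
  by rewrite size_cubic_poly // (rootless_lead rf).
move=> x; apply/negP => /rootP; rewrite horner_Poly /= => E.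
have [|_ /eqP] := rf x 1; last by rewrite oner_eq0.
by rewrite -[RHS]E /binary_cubic; ring.
Qed.

(** If f did not divide h they would be coprime, and a Bezout relation evaluated at the common root
    s would equate 0 with a nonzero constant. *)
Lemma irreducible_dvdp_root (L : fieldExtType F) (f h : {poly F}) (s : L) :
  irreducible_poly f -> root (map_poly (in_alg L) f) s ->
  root (map_poly (in_alg L) h) s -> f %| h.
Proof.
move=> irr /rootP fs /rootP hs.
apply: contraT; rewrite -irreducible_poly_coprime // => /Bezout_coprimepP[[u v]] /=.
move/eqpP => [[k l]] /= /andP[k0 l0] /(congr1 (fun g => (map_poly (in_alg L) g).[s])).
rewrite !linearZ /= rmorphD !rmorphM /= !hornerE fs hs !mulr0 addr0 mulr0.
by rewrite rmorph1 hornerE mulr1 => /eqP; rewrite eq_sym scaler_eq0 oner_eq0 orbF (negPf l0).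
Qed.

(* The cubic divides X^(q^3) - X, which splits over L.                         *)
Lemma rootless_root_ext (L : fieldExtType F) a b c d :
  \dim {:L} = 3%N -> rootless a b c d ->
  exists t : L, a%:A * t ^+ 3 + b%:A * t ^+ 2 + c%:A * t + d%:A = 0.
Proof.
move=> dL rf; have irr := irreducible_rootless rf.
have sz := size_cubic_poly b c d (rootless_lead rf).
set f := cubic_poly a b c d in irr sz.
pose h : {poly F} := 'X^(#|F| ^ 3) - 'X.
have hE (E : fieldExtType F) : map_poly (in_alg E) h = 'X^(#|F| ^ 3) - 'X.
  by rewrite rmorphB /= map_polyXn map_polyX.
have fh : f %| h.
  (* In the extension E obtained by adjoining a root s, which has q^3 elements, s^(q^3) = s; so f
     divides h over F, independently of L. *)
  have [E dE [s fs _]] := irredp_FAdjoin irr.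
  apply: (irreducible_dvdp_root irr fs).
  rewrite hE rootE !hornerE subr_eq0.
  by have := Fermat's_little_theorem {:E} s; rewrite memvf dE sz => /esym.
pose FL := FinFieldExtType L.
have : map_poly (in_alg L) f %| \prod_(x : FL) ('X - x%:P).
  rewrite -finField_genPoly.
  have -> : #|FL| = (#|F| ^ 3)%N.
    pose cL := Vector.class (finvect_type L : vectType F).
    by rewrite -(@card_vspacef F FL cL) card_vspace dL.
  by rewrite -hE dvdp_map.
rewrite -big_enum => /dvdp_prod_XsubC[m].
case: (mask m _) => [|x s]; rewrite ?big_nil ?big_cons.
  by move/eqp_size; rewrite size_map_poly size_poly1 sz.
move/eqp_root/(_ x); rewrite rootM root_XsubC eqxx /= => /rootP E.
by exists x; rewrite -horner_cubic_poly.
Qed.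

(** A nontrivial relation would make (-l, k) a zero of the cubic form; multiplying by k^3 avoids any
    division. *)
Lemma rootless_irrational (L : fieldExtType F) a b c d (t : L) k l :
  rootless a b c d -> a%:A * t ^+ 3 + b%:A * t ^+ 2 + c%:A * t + d%:A = 0 ->
  k%:A * t + l%:A = 0 -> k = 0 /\ l = 0.
Proof.
move=> rf ft /eqP; rewrite addr_eq0 => /eqP kt.
have /eqP : (binary_cubic a b c d (- l) k)%:A = 0 :> L.
  transitivity (k%:A ^+ 3 * (a%:A * t ^+ 3 + b%:A * t ^+ 2 + c%:A * t + d%:A)); last first.
    by rewrite ft mulr0.
  rewrite -!in_algE !(rmorphD, rmorphM, rmorphXn, rmorphN) /= -!in_algE.
  transitivity (in_alg L a * (in_alg L k * t) ^+ 3
    + in_alg L b * (in_alg L k * t) ^+ 2 * in_alg L k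
    + in_alg L c * (in_alg L k * t) * in_alg L k ^+ 2 + in_alg L d * in_alg L k ^+ 3).
    by rewrite [in_alg L k * t]kt.
  ring.
rewrite scaler_eq0 oner_eq0 orbF => /eqP/rf[/eqP + ->].
by rewrite oppr_eq0 => /eqP->.
Qed.

Lemma rootless_quadratic (L : fieldExtType F) a b c d (t : L) k l m :
  rootless a b c d -> a%:A * t ^+ 3 + b%:A * t ^+ 2 + c%:A * t + d%:A = 0 ->
  k%:A * t ^+ 2 + l%:A * t + m%:A = 0 -> [/\ k = 0, l = 0 & m = 0].
Proof.
move=> rf ft qt; have sz := size_cubic_poly b c d (rootless_lead rf).
have : cubic_poly a b c d %| Poly [:: m; l; k].
  apply: (@irreducible_dvdp_root L _ _ t (irreducible_rootless rf)).
    by apply/rootP; rewrite horner_cubic_poly.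
  apply/rootP; rewrite map_Poly_id0 ?rmorph0 // horner_Poly /= -[RHS]qt; ring.
have [/(congr1 (fun g : {poly F} => (g`_0, g`_1, g`_2)))|q0] := eqVneq (Poly [:: m; l; k]) 0.
  by rewrite !coef_Poly !coef0 /= => -[-> -> ->].
move/dvdp_leq => /(_ q0); rewrite sz => h.
by have := leq_trans h (size_Poly _).
Qed.

(** The four elements s t, t, s, 1 of a three-dimensional space are dependent. *)
Lemma proportional_minor (L : fieldExtType F) (s t : L) :
  \dim {:L} = 3%N -> exists A B C D : F,
    [|| A != 0, B != 0, C != 0 | D != 0] /\
    A%:A * (s * t) + B%:A * t + C%:A * s + D%:A = 0.
Proof.
move=> dL; pose P (x : F * F * F * F) :=
  [|| x.1.1.1 != 0, x.1.1.2 != 0, x.1.2 != 0 | x.2 != 0] &&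
  (x.1.1.1%:A * (s * t) + x.1.1.2%:A * t + x.1.2%:A * s + x.2%:A == 0).
have [/existsP[[[[A B] C] D] /andP[/= nz /eqP E]]|] := boolP [exists x, P x].
  by exists A, B, C, D.
rewrite negb_exists => /forallP noP.
have : free [:: s * t; t; s; 1].
  apply/(@freeP _ _ 4 [tuple s * t; t; s; 1]) => k.
  rewrite !big_ord_recl big_ord0 addr0 /= => E.
  have := noP (k ord0, k (lift ord0 ord0), k (lift ord0 (lift ord0 ord0)),
    k (lift ord0 (lift ord0 (lift ord0 ord0)))).
  rewrite /P /= !mulr_algl -!addrA E eqxx andbT !negb_or !negbK.
  case/and4P => /eqP e0 /eqP e1 /eqP e2 /eqP e3.
  by case=> [[|[|[|[|i]]]] hi] //; [rewrite -[RHS]e0 | rewrite -[RHS]e1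
    | rewrite -[RHS]e2 | rewrite -[RHS]e3]; congr k; apply: val_inj.
set X := [:: _; _; _; _] => /eqP dX; have := dimvS (subvf <<X>>%VS).
by rewrite dX dL.
Qed.

(* If t and t' are roots of the two cubics in the field with q^3 elements,     *)
(* a linear relation between 1, t, t', t t' exhibits t' as a homographic       *)
(* function of t, and substituting it in the second cubic gives the first.     *)
Lemma rootless_cubic_planes (a b c d a' b' c' d' : F) :
  rootless a b c d -> rootless a' b' c' d' ->
  cubic_plane a' b' c' d' \in orbit 'P (Kgrp F) (cubic_plane a b c d).
Proof.
move=> rf rf'; have sz := size_cubic_poly b c d (rootless_lead rf).
have [L dL [t /rootP]] := irredp_FAdjoin (irreducible_rootless rf).
rewrite sz in dL; rewrite horner_cubic_poly => ft _.
have [t' ft'] := rootless_root_ext dL rf'.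
have L2 : 2 \in [pchar L] by rewrite (pchar_lalg L).
have [A [B [C [D [ABCD0 E]]]]] := proportional_minor t t' dL.
have irr := rootless_irrational rf ft; have irr' := rootless_irrational rf' ft'.
(* Otherwise A times the relation factors as (A t + B) (A t' + C), and irrationality of t and t'
   forces all four coefficients to vanish. *)
have det0 : C * B + D * A != 0.
  apply/eqP => det0; have : (A%:A * t + B%:A) * (A%:A * t' + C%:A) = 0.
    transitivity (A%:A * (A%:A * (t * t') + B%:A * t' + C%:A * t + D%:A)
        + (C * B + D * A)%:A); last by rewrite E det0 scale0r mulr0 addr0.
    rewrite -!in_algE rmorphD !rmorphM /= -!in_algE; ring2.
  move/eqP; rewrite mulf_eq0 => /orP[] /eqP => [/irr|/irr'] [A0 BC0];
    move: E ABCD0; rewrite A0 BC0 eqxx scale0r !mul0r !add0r ?addr0.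
    by move/irr => [-> ->]; rewrite eqxx.
  by move/irr' => [-> ->]; rewrite eqxx.
(* The coefficients of the second cubic after x |-> C x + D y, y |-> A x + B y, as dictated by t' =
   (C t + D) / (A t + B). *)
pose a1 := a' * C ^+ 3 + b' * C ^+ 2 * A + c' * C * A ^+ 2 + d' * A ^+ 3.
pose b1 := a' * C ^+ 2 * D + b' * C ^+ 2 * B + c' * A ^+ 2 * D + d' * A ^+ 2 * B.
pose c1 := a' * C * D ^+ 2 + b' * D ^+ 2 * A + c' * C * B ^+ 2 + d' * A * B ^+ 2.
pose d1 := a' * D ^+ 3 + b' * D ^+ 2 * B + c' * D * B ^+ 2 + d' * B ^+ 3.
have gt : a1%:A * t ^+ 3 + b1%:A * t ^+ 2 + c1%:A * t + d1%:A = 0.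
  have eN : (A%:A * t + B%:A) * t' = C%:A * t + D%:A.
    by apply: (pchar2_eq L2); rewrite -[RHS]E; ring.
  transitivity ((A%:A * t + B%:A) ^+ 3 *
      (a'%:A * t' ^+ 3 + b'%:A * t' ^+ 2 + c'%:A * t' + d'%:A)); last first.
    by rewrite ft' mulr0.
  transitivity (a'%:A * ((A%:A * t + B%:A) * t') ^+ 3
    + b'%:A * ((A%:A * t + B%:A) * t') ^+ 2 * (A%:A * t + B%:A)
    + c'%:A * ((A%:A * t + B%:A) * t') * (A%:A * t + B%:A) ^+ 2
    + d'%:A * (A%:A * t + B%:A) ^+ 3); last by ring.
  rewrite eN /a1 /b1 /c1 /d1 -!in_algE !(rmorphD, rmorphM, rmorphXn) /= -!in_algE; ring2.
have a10 : a1 != 0.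
  apply/eqP => /rf'[C0 A0]; move: det0; rewrite C0 A0 mul0r mulr0 addr0.
  by rewrite eqxx.
have a0 := rootless_lead rf.
(* The combination of the two cubics that cancels t^3 is a quadratic relation for t, hence zero: the
   cubics are proportional. *)
have [|e1 e2 e3] := @rootless_quadratic L a b c d t (a * b1 + a1 * b)
    (a * c1 + a1 * c) (a * d1 + a1 * d) rf ft.
  transitivity (a%:A * (a1%:A * t ^+ 3 + b1%:A * t ^+ 2 + c1%:A * t + d1%:A)
    + a1%:A * (a%:A * t ^+ 3 + b%:A * t ^+ 2 + c%:A * t + d%:A)); last first.
    by rewrite ft gt !mulr0 addr0.
  rewrite -!in_algE !(rmorphD, rmorphM, rmorphXn) /= -!in_algE; ring2.
apply: (cubic_plane_subst F2 (lam := a / a1) (p := C) (r := D) (u := A) (v := B)) => //.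
- by rewrite mulf_neq0 ?invr_eq0.
- by rewrite -/a1 divfK.
- by rewrite -/b1 mulrAC (pchar2_eq F2 e1) mulrAC divff // mul1r.
- by rewrite -/c1 mulrAC (pchar2_eq F2 e2) mulrAC divff // mul1r.
- by rewrite -/d1 mulrAC (pchar2_eq F2 e3) mulrAC divff // mul1r.
Qed.

(** t^3 + t^2 takes the value 0 at both 0 and 1, so it misses some d, and then x^3 + x^2 y + d y^3
    has no nontrivial zero. *)
Lemma rootless_cubic_exists : exists d, rootless 1 1 0 d.
Proof.
have [||d dP] := @nonsurj_of_collision F (fun t => t ^+ 3 + t ^+ 2) 0 1.
- by rewrite eq_sym oner_neq0.
- by rewrite !expr0n !expr1n add0r [RHS](pcharf0 F2).
exists d => x y; rewrite /binary_cubic => E.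
have [y0|y0] := eqVneq y 0.
  move: E; rewrite y0 => E; split=> //; apply/eqP.
  have /eqP : x ^+ 3 = 0 by rewrite -[RHS]E; ring.
  by rewrite expf_eq0.
have /eqP[] := dP (x / y); apply: (mulfI (expf_neq0 3 y0)).
transitivity ((x / y * y) ^+ 3 + (x / y * y) ^+ 2 * y); first by ring.
rewrite divfK //; apply: (pchar2_eq F2); rewrite -[RHS]E; ring.
Qed.

End CubicNormalForms.

(** * The number of rank-2 points outside the nucleus plane for each normal form *)

Section RankTwoCounts.

Variable F : finFieldType.
Hypothesis F2 : 2 \in [pchar F].
Local Notation q := #|F|.

Lemma card_param (f : F * F -> F * F * F) :
  {in [pred s | s.1 != 0] &, injective f} ->
  #|[set f s | s in setX [set x | x != 0] [set: F]]| = (q.-1 * q)%N.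
Proof.
move=> injf; rewrite card_in_imset ?cardsX ?card_nonzero ?cardsT //.
by move=> [x y] [x' y']; rewrite !in_setX !inE !andbT => x0 x0'; apply: injf.
Qed.

Lemma r2s_line_plane0 : r2s (line_plane0 F) = 0%N.
Proof.
have q1 := card_field_gt1 F; apply/eqP.
rewrite -(@eqn_pmul2r q.-1) -?subn1 ?subn_gt0 // mul0n subn1.
rewrite r2s_vectors //; last exact: veronese_free_line_plane0.
rewrite cards_eq0; apply/eqP/setP => y; rewrite in_set in_set0.
have [y0 [y1 [y2 [y3 [y4 [y5 ->]]]]]] := row6P y.
rewrite mem_line_plane0 mem_nucleus_row6 det_sym_mx //.
apply/negP => /and3P[/and3P[/eqP-> /eqP-> /eqP->]].
rewrite !eqxx /= andbT => y00.
by rewrite !mul0r mulr0 !addr0 -exprS expf_eq0 (negPf y00).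
Qed.

Lemma r2s_line_plane1 : r2s (line_plane1 F) = q.
Proof.
have q1 := card_field_gt1 F; apply/eqP.
rewrite -(@eqn_pmul2r q.-1) -?subn1 ?subn_gt0 // subn1.
rewrite r2s_vectors //; last exact: veronese_free_line_plane1.
rewrite card_span3; last exact: free_line_plane1.
rewrite mulnC -(card_param (f := fun s => (s.1, s.2, 0))); last by move=> [? ?] [? ?] _ _ [-> ->].
apply/eqP; congr #|pred_of_set _|; apply/setP => -[[k l] m]; rewrite in_set /=.
rewrite !row6Z !row6D mem_nucleus_row6 det_sym_mx //.
rewrite !(mulr0, mulr1, addr0, add0r, mul0r, eqxx) /= !andbT.
apply/andP/imsetP => [[k0]|[[x y] /setXP[]]]; rewrite ?inE /=.
  rewrite mulf_eq0 (negPf k0) sqrf_eq0 /= => /eqP->.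
  by exists (k, l); rewrite // !inE k0.
by move=> x0 _ [-> _ ->]; rewrite expr0n mulr0.
Qed.

(** The determinant does not involve the coordinate along the nucleus point, whence the factor q. *)
Lemma r2s_cubic_plane (a b c d : F) : a * d + b * c != 0 ->
  (r2s (cubic_plane a b c d) * q.-1)%N =
  (#|[set s : F * F | ((s.1 != 0) || (s.2 != 0)) &&
    (s.1 * (a * s.1 + c * s.2) ^+ 2 + s.2 * (b * s.1 + d * s.2) ^+ 2 == 0)%R]%R| * q)%N.
Proof.
move=> D0; rewrite r2s_vectors //; last exact/veronese_free_cubic_plane.
rewrite card_span3; last exact: free_cubic_plane.
set S := [set s | _]; rewrite -[X in (_ * X)%N]cardsT -cardsX.
congr #|pred_of_set _|; apply/setP => -[[x y] z]; rewrite in_set in_setX !inE /= andbT.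
rewrite !row6Z !row6D mem_nucleus_row6 det_sym_mx //.
rewrite !(mulr0, mulr1, addr0, add0r, mul0r, eqxx) /= andbT negb_and.
by rewrite (mulrC a) (mulrC b) (mulrC c) (mulrC d).
Qed.

(** At x = u^2, y = v^2 the determinant is the square of the cubic at (u, v). *)
Lemma r2s_rootless (a b c d : F) : a * d + b * c != 0 -> rootless a b c d ->
  r2s (cubic_plane a b c d) = 0%N.
Proof.
move=> D0 rf; have q1 := card_field_gt1 F; apply/eqP.
rewrite -(@eqn_pmul2r q.-1) -?subn1 ?subn_gt0 // subn1 mul0n r2s_cubic_plane //.
rewrite muln_eq0 cards_eq0; apply/orP; left; apply/eqP/setP => -[x y].
rewrite inE in_set0 /=; apply/negP => /andP[].
have [[u <-] [v <-]] := (sqrt_pchar2 F2 x, sqrt_pchar2 F2 y).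
move=> uv0 /eqP E; have [] := rf u v.
  apply/eqP; rewrite -sqrf_eq0 -[X in _ == X]E; apply/eqP.
  by rewrite /binary_cubic; ring2.
by move=> u0 v0; rewrite u0 v0 expr0n eqxx in uv0.
Qed.

Lemma card_axis (f : F -> F * F) : injective f ->
  #|[set f x | x in [set x : F | x != 0%R]]| = q.-1.
Proof. by move=> injf; rewrite card_imset ?card_nonzero. Qed.

Lemma cardsU_disjoint (T : finType) (A B : {set T}) :
  A :&: B = set0 -> #|A :|: B| = (#|A| + #|B|)%N.
Proof. by move=> AB0; rewrite cardsU AB0 cards0 subn0. Qed.

(** The determinant is x y (x + y); each of its three linear factors contributes q - 1 pairs. *)
Lemma r2s_cubic_plane_split : r2s (cubic_plane (0 : F) 1 1 0) = (3 * q)%N.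
Proof.
have q1 := card_field_gt1 F; apply/eqP.
have D0 : (0 : F) * 0 + 1 * 1 != 0 by rewrite mul0r add0r mul1r oner_neq0.
rewrite -(@eqn_pmul2r q.-1) -?subn1 ?subn_gt0 // subn1 r2s_cubic_plane //.
rewrite mulnAC eqn_pmul2r ?(ltnW q1) //.
pose ax (f : F -> F * F) := [set f x | x in [set x : F | x != 0%R]].
set S := [set s | _].
have -> : S = (ax (fun x => (x, 0)) :|: ax (fun x => (0, x))) :|: ax (fun x => (x, x)).
  apply/setP => -[x y]; rewrite !in_setU in_set /= !mul0r !mul1r add0r addr0.
  have -> : x * y ^+ 2 + y * x ^+ 2 = x * y * (x + y) by ring.
  rewrite !mulf_eq0 addr_eq0_pchar2 //; apply/andP/orP.
    case=> + /orP[/orP[]|] /eqP e; rewrite e ?eqxx /= ?orbF ?orbb => h.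
    - by left; apply/orP; right; apply/imsetP; exists y; rewrite ?inE.
    - by left; apply/orP; left; apply/imsetP; exists x; rewrite ?inE.
    - by right; apply/imsetP; exists y; rewrite ?inE.
  by case=> [/orP[]|] /imsetP[z]; rewrite inE => z0 [-> ->]; rewrite z0 eqxx ?orbT.
rewrite !cardsU_disjoint /ax ?card_axis; try by move=> x y [].
- by rewrite !mulSn mul0n addn0 addnA.
- apply/setP => -[x y]; rewrite in_set0 in_setI; apply/negP.
  by case/andP=> /imsetP[s]; rewrite inE => s0 [-> ->] /imsetP[t _ [e _]]; rewrite e eqxx in s0.
- apply/setP => -[x y]; rewrite in_set0 in_setI in_setU; apply/negP.
  case/andP => /orP[] /imsetP[s]; rewrite inE => s0 [-> ->] /imsetP[t _ [e e']].
    by rewrite e -e' eqxx in s0.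
  by rewrite e' -e eqxx in s0.
Qed.

Lemma r2s_cubic_plane_one_root (delta : F) : (forall t, t ^+ 2 + t != delta) ->
  r2s (cubic_plane 0 1 1 delta) = q.
Proof.
move=> dP; have q1 := card_field_gt1 F; apply/eqP.
have D0 : 0 * delta + 1 * 1 != 0 by rewrite mul0r add0r mul1r oner_neq0.
rewrite -(@eqn_pmul2r q.-1) -?subn1 ?subn_gt0 // subn1 r2s_cubic_plane //.
rewrite mulnC eqn_pmul2l ?(ltnW q1) //.
rewrite -(@card_axis (fun x => (x, 0))); last by move=> x y [].
apply/eqP; congr #|pred_of_set _|; apply/setP => -[x y]; rewrite in_set /=.
apply/andP/imsetP => [[xy0 /eqP E]|[t]]; last first.
  by rewrite inE => t0 [-> ->]; rewrite t0; split=> //; apply/eqP; ring.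
have [y0|y0] := eqVneq y 0.
  by exists x; rewrite ?y0 // inE; move: xy0; rewrite y0 eqxx orbF.
(* With x = s^2 y the determinant becomes y^3 (s^2 + s + delta)^2, which is nonzero for y != 0. *)
have [s es] := sqrt_pchar2 F2 (x / y); have := dP s.
case/eqP; apply: sqr_inj_pchar2 => //=; apply: (pchar2_eq F2).
apply: (mulfI (expf_neq0 3 y0)); rewrite mulr0 -[RHS]E.
have -> : x = s ^+ 2 * y by rewrite es divfK.
ring2.
Qed.

Lemma r2s_flag_plane (a b c d : F) : veronese_free (flag_plane a b c d) ->
  (r2s (flag_plane a b c d) * q.-1)%N =
  #|[set t : F * F * F | ((t.1.1 != 0) || (t.1.2 != 0)) &&
    (t.1.1 * (a * t.1.1 + b * t.1.2) ^+ 2 + t.1.2 * t.2 ^+ 2 == 0%R)]|.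
Proof.
move=> fW; rewrite r2s_vectors //.
rewrite card_span3; last exact: free_flag_plane.
congr #|pred_of_set _|; apply/setP => -[[x y] z]; rewrite !in_set /=.
rewrite !row6Z !row6D mem_nucleus_row6 det_sym_mx //.
rewrite !(mulr0, mulr1, addr0, add0r, mul0r, eqxx) /= andbT negb_and.
by rewrite (mulrC a) (mulrC b).
Qed.

Lemma veronese_free_flag_plane_1001 : veronese_free (flag_plane (1 : F) 0 0 1).
Proof.
apply/veronese_free_flag_plane => x y; rewrite mul1r !mul0r addr0 add0r mul1r.
move/eqP; rewrite sqrf_eq0 => /eqP->; rewrite mul0r => /esym/eqP.
by rewrite sqrf_eq0 => /eqP.
Qed.

Lemma veronese_free_flag_plane_0110 : veronese_free (flag_plane (0 : F) 1 1 0).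
Proof.
apply/veronese_free_flag_plane => x y; rewrite mul1r !mul0r addr0 add0r mul1r.
move/eqP; rewrite sqrf_eq0 => /eqP->; rewrite mulr0 => /esym/eqP.
by rewrite sqrf_eq0 => /eqP.
Qed.

Lemma veronese_free_flag_plane_001 (delta : F) : (forall t, t ^+ 2 + t != delta) ->
  veronese_free (flag_plane 0 0 1 delta).
Proof.
move=> dP; apply/veronese_free_flag_plane => x y _ E.
have [y0|y0] := eqVneq y 0.
  move/esym/eqP: E; rewrite y0 mulr0 expr0n mulr0 addr0 mul1r sqrf_eq0.
  by move/eqP.
have /eqP[] := dP (x / y); apply: (mulfI (expf_neq0 2 y0)).
transitivity ((x / y * y) ^+ 2 + (x / y * y) * y); first by ring.
by rewrite divfK // E; ring2.
Qed.

Lemma r2s_flag_plane_1001 : r2s (flag_plane (1 : F) 0 0 1) = q.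
Proof.
have q1 := card_field_gt1 F; apply/eqP.
rewrite -(@eqn_pmul2r q.-1) -?subn1 ?subn_gt0 // subn1.
rewrite r2s_flag_plane; last exact: veronese_free_flag_plane_1001.
(* The singular vectors satisfy x^3 = y z^2 with y != 0; with m the square root of x / y they are (y
   m^2, y, y m^3). *)
rewrite mulnC -(card_param (f := fun s => (s.1 * s.2 ^+ 2, s.1, s.1 * s.2 ^+ 3))); last first.
  move=> [x y] [x' y'] /=; rewrite !inE /= => x0 x0' [+ ex _]; rewrite ex.
  by move/(mulfI x0')/(sqr_inj_pchar2 F2) ->.
apply/eqP; congr #|pred_of_set _|; apply/setP => -[[x y] z]; rewrite in_set /=.
apply/andP/imsetP => [[xy0 /eqP E]|[[s t] /setXP[]]]; last first.
  rewrite inE => s0 _ /= [-> -> ->]; rewrite s0 orbT; split=> //; apply/eqP; ring2.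
have [y0|y0] := eqVneq y 0.
  move: E; rewrite y0 !mul0r !addr0 mul1r -exprS => /eqP; rewrite expf_eq0 /=.
  by move: xy0; rewrite y0 eqxx orbF => /negPf->.
have [m em] := sqrt_pchar2 F2 (x / y); have ex : x = y * m ^+ 2 by rewrite em mulrC divfK.
exists (y, m); first by rewrite !inE y0.
congr (_, _, _) => //; apply: (sqr_inj_pchar2 F2); apply: (mulfI y0) => /=.
by apply: (pchar2_eq F2); rewrite -[RHS]E ex; ring2.
Qed.

Lemma card_axis_plane :
  #|[set (s.1, 0 : F, s.2) | s in setX [set x : F | x != 0] [set: F]]| = (q.-1 * q)%N.
Proof. by rewrite card_param // => -[x y] [x' y'] _ _ [-> ->]. Qed.

Lemma r2s_flag_plane_0110 : r2s (flag_plane (0 : F) 1 1 0) = (2 * q)%N.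
Proof.
have q1 := card_field_gt1 F; apply/eqP.
rewrite -(@eqn_pmul2r q.-1) -?subn1 ?subn_gt0 // subn1.
rewrite r2s_flag_plane; last exact: veronese_free_flag_plane_0110.
have -> : (2 * q * q.-1 = q.-1 * q + q.-1 * q)%N by rewrite mulnC mul2n -addnn mulnDr.
(* The determinant is y (x y + z^2): the locus is the line y = 0 and the conic x y = z^2,
   parametrised where y != 0 by (s t^2, s, s t). *)
rewrite -{1}card_axis_plane -(card_param (f := fun s => (s.1 * s.2 ^+ 2, s.1, s.1 * s.2))); last first.
  move=> [x y] [x' y'] /=; rewrite !inE /= => x0 x0' [_ ex +]; rewrite ex.
  by move/(mulfI x0') ->.
rewrite -cardsU_disjoint; last first.
  apply/setP => -[[x y] z]; rewrite in_set0 in_setI; apply/negP.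
  case/andP => /imsetP[s _ [_ -> _]] /imsetP[[t t'] /setXP[]].
  by rewrite inE => t0 _ [_ e _]; rewrite -e eqxx in t0.
apply/eqP; congr #|pred_of_set _|; apply/setP => -[[x y] z]; rewrite in_set in_setU /=.
apply/andP/orP => [[xy0 /eqP E]|[] /imsetP[[s t] /setXP[]]]; last 2 first.
- by rewrite inE => s0 _ /= [-> -> ->]; rewrite s0; split=> //; apply/eqP; ring.
- by rewrite inE => s0 _ /= [-> -> ->]; rewrite s0 orbT; split=> //; apply/eqP; ring2.
have [y0|y0] := eqVneq y 0.
  by left; apply/imsetP; exists (x, z); rewrite ?y0 // !inE andbT; move: xy0; rewrite y0 eqxx orbF.
right; apply/imsetP; exists (y, z / y); first by rewrite !inE y0.
congr (_, _, _) => //=; last by rewrite mulrC divfK.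
apply: (mulfI y0); apply: (mulfI y0); apply: (pchar2_eq F2).
transitivity (x * (0 * x + 1 * y) ^+ 2 + y * (z / y * y) ^+ 2); first by ring.
by rewrite divfK.
Qed.

Lemma r2s_flag_plane_001 (delta : F) : (forall t, t ^+ 2 + t != delta) ->
  r2s (flag_plane 0 0 1 delta) = (2 * q)%N.
Proof.
move=> dP; have q1 := card_field_gt1 F; apply/eqP.
rewrite -(@eqn_pmul2r q.-1) -?subn1 ?subn_gt0 // subn1.
rewrite r2s_flag_plane; last exact: veronese_free_flag_plane_001.
have -> : (2 * q * q.-1 = q.-1 * q + q.-1 * q)%N by rewrite mulnC mul2n -addnn mulnDr.
rewrite -{1}card_axis_plane -(card_param (f := fun s => (s.2, s.1, 0))); last first.
  by move=> [x y] [x' y'] _ _ [-> ->].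
rewrite -cardsU_disjoint; last first.
  apply/setP => -[[x y] z]; rewrite in_set0 in_setI; apply/negP.
  case/andP => /imsetP[s _ [_ -> _]] /imsetP[[t t'] /setXP[]].
  by rewrite inE => t0 _ [_ e _]; rewrite -e eqxx in t0.
apply/eqP; congr #|pred_of_set _|; apply/setP => -[[x y] z]; rewrite in_set in_setU /=.
rewrite !mul0r addr0 expr0n mulr0 add0r mulf_eq0 sqrf_eq0.
apply/andP/orP => [[xy0 /orP[]/eqP E]|[] /imsetP[[s t] /setXP[]]]; last 2 first.
- by rewrite inE => s0 _ /= [-> -> ->]; rewrite s0 eqxx.
- by rewrite inE => s0 _ /= [-> -> ->]; rewrite s0 orbT eqxx orbT.
- by left; apply/imsetP; exists (x, z); rewrite ?E // !inE andbT; move: xy0; rewrite E eqxx orbF.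
have [y0|y0] := eqVneq y 0.
  by left; apply/imsetP; exists (x, z); rewrite ?y0 // !inE andbT; move: xy0; rewrite y0 eqxx orbF.
by right; apply/imsetP; exists (y, x); rewrite ?E // !inE y0.
Qed.

End RankTwoCounts.

(** * Invariants separating orbits with equal distributions *)

Section Invariants.

Variable F : finFieldType.
Hypothesis F2 : 2 \in [pchar F].
Implicit Types W : {vspace 'rV[F]_6}.

Lemma orbit_neq (P : {vspace 'rV[F]_6} -> Prop) W W' :
  (forall A V, A \in unitmx -> P V -> P (cong_vspace A V)) -> P W -> ~ P W' ->
  orbit 'P (Kgrp F) W != orbit 'P (Kgrp F) W'.
Proof.
move=> invP PW nPW'; apply/eqP => E; apply: nPW'.
have /orbit_congP[A uA ->] : W' \in orbit 'P (Kgrp F) W by rewrite E orbit_refl.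
exact: invP.
Qed.

Lemma orbit_neq_r2s W W' : r2s W != r2s W' ->
  orbit 'P (Kgrp F) W != orbit 'P (Kgrp F) W'.
Proof.
move=> neq; apply: (orbit_neq (P := fun V => r2s V = r2s W)) => // [A V uA <-|E].
  by have [] := OD0_cong F2 V uA.
by rewrite E eqxx in neq.
Qed.

(* In W = cubic_plane a b c d the nucleus point does not move the              *)
(* determinant; this separates the orbits with OD0 = [0, 1, q, q^2].          *)
Definition nucleus_tangent W := exists n,
  [/\ n != 0, n \in W, n \in nucleus_plane F
    & forall y, y \in W -> \det (sym_mx (y + n)) = \det (sym_mx y)].

Lemma nucleus_tangent_cong (A : 'M[F]_3) W : A \in unitmx ->
  nucleus_tangent W -> nucleus_tangent (cong_vspace A W).
Proof.
move=> uA [n [n0 Wn Nn dn]]; exists (cong_map A n); split.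
- by apply: contra n0 => /eqP E; apply/eqP/(cong_map_inj uA); rewrite E linear0.
- by apply/cong_vspaceP; exists n.
- by rewrite cong_nucleus.
by move=> _ /cong_vspaceP[y Wy ->]; rewrite -linearD /= !sym_mx_cong !det_mulmx dn.
Qed.

Lemma nucleus_tangent_cubic_plane (a b c d : F) : nucleus_tangent (cubic_plane a b c d).
Proof.
exists (row6 0 1 0 0 0 0); split.
- by rewrite row6_neq0 // oner_neq0 orbT.
- by rewrite mem_cubic_plane !mulr0 addr0 eqxx.
- by rewrite mem_nucleus_row6 eqxx.
move=> y; have [y0 [y1 [y2 [y3 [y4 [y5 ->]]]]]] := row6P y.
rewrite mem_cubic_plane => /and3P[_ _ /eqP->].
by rewrite row6D !det_sym_mx // !addr0 !mul0r.
Qed.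

Lemma nucleus_tangent_flag_plane (a b c d : F) : ~ nucleus_tangent (flag_plane a b c d).
Proof.
case=> n [n0 Wn Nn dn]; have : n \in (flag_plane a b c d :&: nucleus_plane F)%VS.
  by rewrite memv_cap Wn.
rewrite cap_flag_plane => /vlineP[k ek]; case/eqP: n0; rewrite ek.
(* At this vector the determinant is 0, and adding k times the nucleus point makes it k^2, so k must
   vanish. *)
have W1 : row6 0 d 0 1 b 0 \in flag_plane a b c d.
  by rewrite mem_flag_plane !mulr0 !mulr1 !add0r !eqxx.
have := dn _ W1; rewrite ek row6Z row6D !det_sym_mx //.
rewrite !(mulr0, mulr1, addr0, add0r, mul0r, mul1r, expr0n) /= => /eqP.
by rewrite sqrf_eq0 => /eqP->; rewrite row6_0.
Qed.

(* This separates the two orbits with OD0 = [0, 1, 2q, q^2 - q].               *)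
Definition common_conjugates W := exists u v : 'rV[F]_3,
  [/\ v != 0, ~~ (u <= v)%MS
    & forall y, y \in W -> v *m sym_mx y *m v^T = 0 /\ v *m sym_mx y *m u^T = 0].

Lemma common_conjugates_cong (A : 'M[F]_3) W : A \in unitmx ->
  common_conjugates W -> common_conjugates (cong_vspace A W).
Proof.
move=> uA [u [v [v0 uv Wuv]]]; have uB : invmx A \in unitmx by rewrite unitmx_inv.
exists (u *m invmx A), (v *m invmx A); split.
- by apply: contra v0 => /eqP E; rewrite -[v](mulmxKV uA) E mul0mx.
- by rewrite submxMfree // row_free_unit.
move=> _ /cong_vspaceP[y /Wuv[vv vu] ->].
by rewrite sym_mx_cong -!mulmxA -!trmx_mul !mulmxKV // !mulmxA mulmxKV.
Qed.

Lemma row3_mul_sym (x y z x' y' z' a b c d e f : F) :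
  (row3 x y z *m sym_mx (row6 a b c d e f) *m (row3 x' y' z')^T) 0 0 =
  x * (a * x' + b * y' + c * z') + y * (b * x' + d * y' + e * z')
    + z * (c * x' + e * y' + f * z').
Proof.
rewrite sym_mx_row6; do ![rewrite !mxE /= ?big_ord_recl ?big_ord0].
by rewrite /=; ring.
Qed.

(** With a = b = 0 the entries (1, 2) and (2, 2) vanish on the whole plane, so the last two basis
    vectors will do. *)
Lemma common_conjugates_flag_plane (c d : F) : common_conjugates (flag_plane 0 0 c d).
Proof.
exists (row3 0 1 0), (row3 0 0 1); split.
- by rewrite row3_eq0 oner_eq0 !andbF.
- apply/sub_rVP => -[k /rowP/(_ 1)]; rewrite !mxE /= mulr0.
  by move/eqP; rewrite oner_eq0.
move=> y; have [y0 [y1 [y2 [y3 [y4 [y5 ->]]]]]] := row6P y.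
rewrite mem_flag_plane !mul0r addr0 => /and3P[_ /eqP-> /eqP->].
by split; apply/matrixP => i j; rewrite !ord1 row3_mul_sym mxE; ring.
Qed.

Lemma not_common_conjugates_flag_plane : ~ common_conjugates (flag_plane (0 : F) 1 1 0).
Proof.
case=> u [v [v0 uv Wuv]]; have [x' [y' [z' eu]]] := row3P u.
have [x [y [z ev]]] := row3P v; subst u v.
have eqs k l m :
  x * (k * x + k * y + m * z) + y * (k * x + l * y + l * z) + z * (m * x + l * y) = 0
  /\ x * (k * x' + k * y' + m * z') + y * (k * x' + l * y' + l * z')
     + z * (m * x' + l * y') = 0.
  have /Wuv[/matrixP/(_ 0 0) + /matrixP/(_ 0 0)] :
      row6 k k m l l 0 \in flag_plane (0 : F) 1 1 0.
    by rewrite mem_flag_plane !mul1r !mul0r addr0 add0r !eqxx.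
  by rewrite !row3_mul_sym !mxE !mul0r !addr0.
(* Evaluating at the three generators leaves x^2 = 0 and y^2 = 0 by parity, and then x' = y' = 0, so
   u would be a multiple of v. *)
have x0 : x = 0.
  have [+ _] := eqs 1 0 0; move=> E; apply/eqP; rewrite -sqrf_eq0 -E; apply/eqP; ring2.
have y0 : y = 0.
  have [+ _] := eqs 0 1 0; move=> E; apply/eqP; rewrite -sqrf_eq0 -E; apply/eqP; ring2.
subst x y; have z0 : z != 0 by move: v0; rewrite row3_eq0 !eqxx.
have x'0 : x' = 0.
  by have [_ E] := eqs 0 0 1; apply: (mulfI z0); rewrite mulr0 -[RHS]E; ring.
have y'0 : y' = 0.
  by have [_ E] := eqs 0 1 0; apply: (mulfI z0); rewrite mulr0 -[RHS]E; ring.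
case/negP: uv; apply/sub_rVP; exists (z' / z); rewrite x'0 y'0.
by apply/rowP; case=> [[|[|[|i]]] hi] //; rewrite !mxE /= ?mulr0 ?divfK.
Qed.

End Invariants.

(** * Counting orbits from a complete list of inequivalent representatives *)

Section OrbitCounting.

Variable F : finFieldType.
Hypothesis F2 : 2 \in [pchar F].
Variables (S : {set {vspace 'rV[F]_6}}) (rs : seq {vspace 'rV[F]_6}).
Hypothesis rsS : {subset rs <= S}.
Hypothesis rs_cover : forall W, W \in S -> exists2 R, R \in rs & R \in orbit 'P (Kgrp F) W.
Hypothesis rs_uniq : uniq [seq orbit 'P (Kgrp F) R | R <- rs].

Lemma mem_Korbits O : (O \in Korbits S) = (O \in [seq orbit 'P (Kgrp F) R | R <- rs]).
Proof.
apply/imsetP/mapP => [[W SW ->]|[R rsR ->]]; last by exists R; rewrite ?rsS.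
by have [R rsR /orbit_eqP oR] := rs_cover SW; exists R.
Qed.

Lemma card_Korbits : #|Korbits S| = size rs.
Proof. by rewrite (eq_card mem_Korbits) (card_uniqP rs_uniq) size_map. Qed.

(** [OD0] is constant along an orbit, so it suffices to test the representative. *)
Lemma card_Korbits_OD0 d :
  #|[set O in Korbits S | [forall W in O, OD0 W == d]]| = count_mem d [seq OD0 R | R <- rs].
Proof.
rewrite count_map.
have Od R : [forall W in orbit 'P (Kgrp F) R, OD0 W == d] = (OD0 R == d).
  apply/forall_inP/idP => [|/eqP <- W oW]; first by apply; apply: orbit_refl.
  by rewrite (OD0_orbit F2 oW).
pose s := [seq orbit 'P (Kgrp F) R | R <- rs & OD0 R == d].
have us : uniq s := subseq_uniq (map_subseq _ (filter_subseq _ rs)) rs_uniq.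
rewrite -size_filter -(size_map (fun R => orbit 'P (Kgrp F) R)) -/s -(card_uniqP us).
apply: eq_card => O; rewrite inE mem_Korbits.
apply/andP/mapP => [[/mapP[R rsR ->]]|[R + ->]].
  by rewrite Od => dR; exists R; rewrite // mem_filter dR.
by rewrite mem_filter Od => /andP[-> rsR]; split=> //; apply: map_f.
Qed.

End OrbitCounting.

Lemma even_card_pchar2 (F : finFieldType) : ~~ odd #|F| -> 2 \in [pchar F].
Proof.
have [p pr_p chp] := finPcharP F; rewrite (card_pprimeChar chp) oddX negb_or.
by case/andP => _; case: (even_prime pr_p) chp => [->|->].
Qed.

(** A rewriting bundle that decides every comparison between the values 0, q, 2q, 3q of [r2s]. *)
Lemma multiples_neq (n : nat) : (1 < n)%N ->
  (((0 == n)%N = false) * ((0 == 2 * n)%N = false) * ((0 == 3 * n)%N = false) *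
   ((n == 2 * n)%N = false) * ((n == 3 * n)%N = false) * ((2 * n == 3 * n)%N = false) *
   ((n == 0)%N = false) * ((2 * n == 0)%N = false) * ((3 * n == 0)%N = false) *
   ((2 * n == n)%N = false) * ((3 * n == n)%N = false) * ((3 * n == 2 * n)%N = false)).
Proof. by move=> n1; do !split; apply/negbTE; lia. Qed.

(** * Assembling the classification *)

Section Classification.

Variable F : finFieldType.
Hypothesis F2 : 2 \in [pchar F].
Local Notation q := #|F|.
Implicit Types W : {vspace 'rV[F]_6}.

Definition veronese_disjoint_planes : {set {vspace 'rV[F]_6}} :=
  [set pi in planes F |
    (pts pi :&: veronese F == set0) && (pts pi :&: pts (nucleus_plane F) != set0)].

Definition meeting_in_line : {set {vspace 'rV[F]_6}} :=
  [set pi in veronese_disjoint_planes | (pi :&: nucleus_plane F)%VS \in o12_1 F].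

Definition meeting_in_point : {set {vspace 'rV[F]_6}} :=
  [set pi in veronese_disjoint_planes | (pi :&: nucleus_plane F)%VS \in points F].

Lemma veronese_disjoint_planesP W :
  reflect [/\ \dim W = 3%N, veronese_free W & \dim (W :&: nucleus_plane F) != 0%N]
          (W \in veronese_disjoint_planes).
Proof.
rewrite in_set in_set; have -> : (pts W :&: pts (nucleus_plane F) != set0) =
    (\dim (W :&: nucleus_plane F) != 0%N).
  rewrite -cards_eq0 -/(r2n W) r2n_dim; case: (\dim _) => [|n]; first by rewrite big_ord0.
  by rewrite big_ord_recl.
apply: (iffP and3P) => [[/eqP dW /veronese_freeP fW dN]|[dW fW dN]]; split=> //.
- by rewrite dW.
- exact/veronese_freeP.
Qed.

Lemma o12_1_dim W : ((W :&: nucleus_plane F)%VS \in o12_1 F) =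
  (\dim (W :&: nucleus_plane F) == 2%N).
Proof. by rewrite !inE capvSr andbT. Qed.

Lemma OD0_meeting_in_line W : W \in meeting_in_line ->
  OD0 W = [:: 0; q + 1; r2s W; q ^ 2 - r2s W]%N.
Proof.
rewrite in_set o12_1_dim => /andP[/veronese_disjoint_planesP[dW fW _] /eqP dN].
rewrite OD0_veronese_free // r2n_dim dN !big_ord_recl big_ord0 /= expn0 expn1 addn0 addnC.
by rewrite -addnA addnK.
Qed.

Lemma OD0_meeting_in_point W : W \in meeting_in_point ->
  OD0 W = [:: 0; 1; r2s W; q ^ 2 + q - r2s W]%N.
Proof.
rewrite in_set => /andP[/veronese_disjoint_planesP[dW fW _]]; rewrite in_set => /eqP dN.
rewrite OD0_veronese_free // r2n_dim dN big_ord_recl big_ord0 /= expn0 addn0.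
by rewrite addnK.
Qed.

Definition line_plane_reps := [:: line_plane0 F; line_plane1 F].

Lemma line_plane_reps_sub : {subset line_plane_reps <= meeting_in_line}.
Proof.
move=> W; rewrite in_cons mem_seq1 => /orP[] /eqP ->; rewrite in_set o12_1_dim; apply/andP.
  rewrite cap_line_plane0 dim_nucleus_line; split=> //.
  apply/veronese_disjoint_planesP; rewrite cap_line_plane0 dim_nucleus_line.
  by rewrite dim_line_plane0; split=> //; apply: veronese_free_line_plane0.
rewrite cap_line_plane1 dim_nucleus_line; split=> //.
apply/veronese_disjoint_planesP; rewrite cap_line_plane1 dim_nucleus_line.
by rewrite dim_line_plane1; split=> //; apply: veronese_free_line_plane1.
Qed.

Lemma line_plane_reps_cover W : W \in meeting_in_line ->
  exists2 R, R \in line_plane_reps & R \in orbit 'P (Kgrp F) W.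
Proof.
rewrite in_set => /andP[/veronese_disjoint_planesP[dW fW _] oN].
have [o|o] := line_plane_reduction F2 dW fW oN.
  by exists (line_plane0 F); rewrite ?inE ?eqxx.
by exists (line_plane1 F); rewrite ?inE ?eqxx ?orbT.
Qed.

Lemma line_plane_reps_uniq : uniq [seq orbit 'P (Kgrp F) R | R <- line_plane_reps].
Proof.
rewrite /= inE andbT; apply: (orbit_neq_r2s F2).
by rewrite r2s_line_plane0 // r2s_line_plane1 // multiples_neq // card_field_gt1.
Qed.

Variables delta epsilon : F.
Hypothesis deltaP : forall t, t ^+ 2 + t != delta.
Hypothesis epsilonP : rootless 1 1 0 epsilon.

(** The cubic planes with zero, three and one root, then the three flag planes. *)
Definition point_plane_reps :=
  [:: cubic_plane 1 1 0 epsilon; cubic_plane 0 1 1 0; cubic_plane 0 1 1 delta;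
      flag_plane 1 0 0 1; flag_plane 0 1 1 0; flag_plane 0 0 1 delta].

Lemma epsilon_disc : 1 * epsilon + 1 * 0 != 0.
Proof.
rewrite mul1r mulr0 addr0; apply/eqP => e0.
have [|_ /eqP] := epsilonP (x := 0) (y := 1); last by rewrite oner_eq0.
by rewrite /binary_cubic e0; ring.
Qed.

Lemma unit_disc d : 0 * d + 1 * 1 != 0 :> F.
Proof. by rewrite mul0r add0r mul1r oner_neq0. Qed.

Lemma cubic_plane_meeting (a b c d : F) : a * d + b * c != 0 ->
  cubic_plane a b c d \in meeting_in_point.
Proof.
move=> D0; have dN : \dim (cubic_plane a b c d :&: nucleus_plane F) = 1%N.
  by rewrite cap_cubic_plane dim_vline row6_neq0 // oner_neq0 orbT.
rewrite in_set [X in _ && X]in_set dN eqxx andbT; apply/veronese_disjoint_planesP.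
by rewrite dN dim_cubic_plane; split=> //; apply/veronese_free_cubic_plane.
Qed.

Lemma flag_plane_meeting (a b c d : F) : veronese_free (flag_plane a b c d) ->
  flag_plane a b c d \in meeting_in_point.
Proof.
move=> fW; have dN : \dim (flag_plane a b c d :&: nucleus_plane F) = 1%N.
  by rewrite cap_flag_plane dim_vline row6_neq0 // oner_neq0 !orbT.
rewrite in_set [X in _ && X]in_set dN eqxx andbT; apply/veronese_disjoint_planesP.
by rewrite dN dim_flag_plane.
Qed.

Lemma point_plane_reps_sub : {subset point_plane_reps <= meeting_in_point}.
Proof.
apply/allP; rewrite /= !cubic_plane_meeting ?epsilon_disc ?unit_disc //=.
rewrite !flag_plane_meeting //; first exact: veronese_free_flag_plane_001.
- exact: veronese_free_flag_plane_0110.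
- exact: veronese_free_flag_plane_1001.
Qed.

Lemma rootlessVroot (a b c d : F) : rootless a b c d \/
  exists x y, (x != 0) || (y != 0) /\ binary_cubic a b c d x y = 0.
Proof.
pose P (s : F * F) :=
  ((s.1 != 0) || (s.2 != 0)) && (binary_cubic a b c d s.1 s.2 == 0).
have [/existsP[[x y] /andP[/= xy0 /eqP fxy]]|] := boolP [exists s, P s].
  by right; exists x, y.
rewrite negb_exists => /forallP noP; left=> x y /eqP fxy.
have := noP (x, y); rewrite /P /= fxy andbT negb_or !negbK.
by case/andP => /eqP-> /eqP->.
Qed.

Lemma cubic_plane_cover (a b c d : F) : a * d + b * c != 0 ->
  exists2 R, R \in point_plane_reps & R \in orbit 'P (Kgrp F) (cubic_plane a b c d).
Proof.
move=> D0; have [rf|[x [y [xy0 fxy]]]] := rootlessVroot a b c d.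
  exists (cubic_plane 1 1 0 epsilon); first by rewrite !inE eqxx.
  exact: rootless_cubic_planes.
have [o|o] := cubic_plane_root_normal_form F2 deltaP D0 xy0 fxy.
  by exists (cubic_plane 0 1 1 0); rewrite // !inE eqxx ?orbT.
by exists (cubic_plane 0 1 1 delta); rewrite // !inE eqxx ?orbT.
Qed.

Lemma point_plane_reps_cover W : W \in meeting_in_point ->
  exists2 R, R \in point_plane_reps & R \in orbit 'P (Kgrp F) W.
Proof.
rewrite in_set => /andP[/veronese_disjoint_planesP[dW fW _]]; rewrite in_set => /eqP dN.
have [a [b [c [d [o|o]]]]] := point_plane_reduction F2 dW dN.
  have /(veronese_free_cubic_plane F2) D0 := orbit_veronese_free o fW.
  have [R rsR oR] := cubic_plane_cover D0.
  by exists R => //; apply: orbit_trans oR o.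
have := flag_plane_normal_form F2 deltaP (orbit_veronese_free o fW).
by case=> oR; eexists; [| exact: orbit_trans oR o | | exact: orbit_trans oR o
  | | exact: orbit_trans oR o]; rewrite !inE eqxx ?orbT.
Qed.

Lemma point_plane_reps_r2s : [seq r2s R | R <- point_plane_reps] =
  [:: 0; 3 * q; q; q; 2 * q; 2 * q]%N.
Proof.
rewrite /= r2s_rootless ?epsilon_disc // r2s_cubic_plane_split //.
rewrite r2s_cubic_plane_one_root // r2s_flag_plane_1001 //.
by rewrite r2s_flag_plane_0110 // r2s_flag_plane_001.
Qed.

Lemma point_plane_reps_uniq : uniq [seq orbit 'P (Kgrp F) R | R <- point_plane_reps].
Proof.
have q1 := card_field_gt1 F; have [e0 e1 e2 e3 e4 e5] := point_plane_reps_r2s.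
rewrite /= !inE !negb_or !andbT; repeat (apply/andP; split);
  try by apply: (orbit_neq_r2s F2); rewrite ?e0 ?e1 ?e2 ?e3 ?e4 ?e5 (multiples_neq q1).
(* Two pairs share their value of [r2s]: the one-root cubic plane with the first flag plane (q), and
   the last two flag planes (2q). *)
- apply: (orbit_neq (P := @nucleus_tangent F)).
  + by move=> A V; apply: nucleus_tangent_cong.
  + exact: (nucleus_tangent_cubic_plane F2).
  + exact: (nucleus_tangent_flag_plane F2).
- rewrite eq_sym; apply: (orbit_neq (P := @common_conjugates F)).
  + by move=> A V; apply: common_conjugates_cong.
  + exact: common_conjugates_flag_plane.
  + exact: (not_common_conjugates_flag_plane F2).
Qed.

Lemma point_plane_reps_OD0 : [seq OD0 R | R <- point_plane_reps] =
  [:: [:: 0; 1; 0; q ^ 2 + q]; [:: 0; 1; 3 * q; q ^ 2 - 2 * q];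
      [:: 0; 1; q; q ^ 2]; [:: 0; 1; q; q ^ 2];
      [:: 0; 1; 2 * q; q ^ 2 - q]; [:: 0; 1; 2 * q; q ^ 2 - q]]%N.
Proof.
have [e0 e1 e2 e3 e4 e5] := point_plane_reps_r2s.
have sub := point_plane_reps_sub.
rewrite /= !OD0_meeting_in_point ?sub ?inE ?eqxx ?orbT // e0 e1 e2 e3 e4 e5.
rewrite subn0 addnK (mulSn 2) (mulSn 1) mul1n addnC.
by rewrite !subnDl.
Qed.

Lemma line_plane_reps_OD0 : [seq OD0 R | R <- line_plane_reps] =
  [:: [:: 0; q + 1; 0; q ^ 2]; [:: 0; q + 1; q; q ^ 2 - q]]%N.
Proof.
have sub := line_plane_reps_sub.
rewrite /= !OD0_meeting_in_line ?sub ?inE ?eqxx ?orbT //.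
by rewrite r2s_line_plane0 // r2s_line_plane1 // subn0.
Qed.

(** The intersection has dimension 1, 2 or 3; in the last case both planes equal it, since the
    nucleus plane has dimension at most 3. *)
Lemma veronese_disjoint_planes_cases W : W \in veronese_disjoint_planes ->
  [\/ W = nucleus_plane F, W \in meeting_in_line | W \in meeting_in_point].
Proof.
move=> OW; have /veronese_disjoint_planesP[dW fW dN] := OW.
have dNP : (\dim (nucleus_plane F) <= 3)%N.
  have eN : nucleus_plane F = <<[:: row6 0 1 0 0 0 0; row6 0 0 1 0 0 0; row6 0 0 0 0 1 0]>>%VS.
    apply/vspaceP => y; have [y0 [y1 [y2 [y3 [y4 [y5 ->]]]]]] := row6P y.
    rewrite mem_nucleus_row6; apply/and3P/mem_span3P => [[/eqP-> /eqP-> /eqP->]|[a [b [c]]]].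
      by exists y1, y2, y4; rewrite !row6Z !row6D; congr row6; ring.
    by rewrite !row6Z !row6D !mulr0 !addr0 => /row6_inj[[-> _ _] [-> _ ->]].
  by rewrite eN; apply: dim_span.
have dWN : (\dim (W :&: nucleus_plane F) <= 3)%N := leq_trans (dimvS (capvSl _ _)) (eq_leq dW).
case: (ltngtP (\dim (W :&: nucleus_plane F)) 2) dWN => [d1|d3|d2] dWN.
- by constructor 3; rewrite in_set OW [X in _ && X]in_set; move: dN d1; case: (\dim _) => [|[|]].
- have d3' : \dim (W :&: nucleus_plane F) = 3%N by apply/eqP; rewrite eqn_leq dWN.
  constructor 1; transitivity (W :&: nucleus_plane F)%VS.
    by apply/esym/eqP; rewrite eqEdim capvSl d3' dW.
  by apply/eqP; rewrite eqEdim capvSr d3'.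
- by constructor 2; rewrite in_set OW o12_1_dim d2.
Qed.

End Classification.

Local Close Scope ring_scope.

Theorem theorem4p8 (F : finFieldType) (q_even : ~~ odd #|F|) :
  let q := #|F| in
  let piN := nucleus_plane F in
  let Omega := [set pi in planes F |
    (pts pi :&: veronese F == set0) && (pts pi :&: pts piN != set0)] in
  let Omega_line := [set pi in Omega | (pi :&: piN)%VS \in o12_1 F] in
  let Omega_point := [set pi in Omega | (pi :&: piN)%VS \in points F] in
  let orbits_with S d :=
    [set O in Korbits S | [forall pi in O, OD0 pi == d]] in
  [/\ forall pi : {vspace 'rV[F]_6}, pi \in Omega ->
        [\/ pi = piN,
            (pi :&: piN)%VS \in o12_1 F /\ (r2s pi = 0 \/ r2s pi = q)
          | (pi :&: piN)%VS \in points F /\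
            [\/ r2s pi = 0, r2s pi = q, r2s pi = 2 * q | r2s pi = 3 * q]],
      [/\ #|Korbits Omega_line| = 2,
          #|orbits_with Omega_line [:: 0; q + 1; 0; q ^ 2]| = 1
        & #|orbits_with Omega_line [:: 0; q + 1; q; q ^ 2 - q]| = 1]
    & [/\ #|Korbits Omega_point| = 6,
          #|orbits_with Omega_point [:: 0; 1; 0; q ^ 2 + q]| = 1,
          #|orbits_with Omega_point [:: 0; 1; 3 * q; q ^ 2 - 2 * q]| = 1,
          #|orbits_with Omega_point [:: 0; 1; q; q ^ 2]| = 2
        & #|orbits_with Omega_point [:: 0; 1; 2 * q; q ^ 2 - q]| = 2]].
Proof.
have F2 := even_card_pchar2 q_even.
have [delta deltaP] := artin_schreier_nonsurj F2.
have [epsilon epsilonP] := rootless_cubic_exists F2.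
move=> q piN Omega Omega_line Omega_point orbits_with.
have q1 : 1 < q := card_field_gt1 F.
have neqE := multiples_neq q1.
have lineE := card_Korbits_OD0 F2 (@line_plane_reps_sub F)
  (line_plane_reps_cover F2) (line_plane_reps_uniq F2).
have pointE := card_Korbits_OD0 F2 (point_plane_reps_sub F2 deltaP epsilonP)
  (point_plane_reps_cover F2 deltaP epsilonP) (point_plane_reps_uniq F2 deltaP epsilonP).
rewrite line_plane_reps_OD0 // in lineE; rewrite point_plane_reps_OD0 // in pointE.
have [s0 s1 s2 s3 s4 s5] := point_plane_reps_r2s F2 deltaP epsilonP.
split.
- move=> pi /veronese_disjoint_planes_cases[->|lpi|ppi]; first by constructor 1.
    constructor 2; split; first by move: lpi; rewrite in_set => /andP[].
    (* The third entry of [OD0] transports [r2s] from the representative to the given plane. *)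
    have [R + /(OD0_orbit F2)[_ _ <- _]] := line_plane_reps_cover F2 lpi.
    rewrite !inE => /orP[] /eqP ->; first by left; apply: r2s_line_plane0.
    by right; apply: r2s_line_plane1.
  constructor 3; split; first by move: ppi; rewrite in_set => /andP[].
  have [R + /(OD0_orbit F2)[_ _ <- _]] := point_plane_reps_cover F2 deltaP epsilonP ppi.
  rewrite !inE => /or4P[/eqP->|/eqP->|/eqP->|/or3P[]/eqP->].
  + by constructor 1.
  + by constructor 4.
  + by constructor 2.
  + by constructor 2.
  + by constructor 3.
  + by constructor 3.
- split; last 2 first.
  + by rewrite [LHS]lineE /= !eqseq_cons !eqxx /= -/q !neqE.
  + by rewrite [LHS]lineE /= !eqseq_cons !eqxx /= -/q !neqE.
  exact: (card_Korbits (@line_plane_reps_sub F)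
    (line_plane_reps_cover F2) (line_plane_reps_uniq F2)).
- split; last 4 first.
  1-4: by rewrite [LHS]pointE /= !eqseq_cons !eqxx /= -/q !neqE.
  exact: (card_Korbits (point_plane_reps_sub F2 deltaP epsilonP)
    (point_plane_reps_cover F2 deltaP epsilonP) (point_plane_reps_uniq F2 deltaP epsilonP)).
Qed.
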